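(* Let $\mathbb{F}$ be an algebraically closed field of characteristic $\neq 2$, and let $V$ be an infinite-dimensional vector space over $\mathbb{F}$ with a nondegenerate quadratic form $f$. Let $\varphi\colon V\to V$ be an orthogonal linear transformation, and for $\alpha\in\mathbb{F}$ put $V(\alpha)=\ker(\varphi-\alpha\cdot\mathrm{Id})$. The Bogolyubov automorphism $[\varphi]$ of the Clifford algebra $\mathrm{Cl}(V)=\mathrm{Cl}(V,f)$ is inner if and only if one of the following holds: (1) $\varphi$ is finitary and either $\varphi=\mathrm{Id}$ or $\det\left(\varphi|_{V/V(1)}\right)=1$; or (2) $-\varphi$ is finitary, $\varphi\neq-\mathrm{Id}$, $\dim_{\mathbb{F}}(V/V(-1))=k\ge 1$, and $$(-1)^k\cdot\det\left(\varphi|_{V/V(-1)}\right)=-1.$$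
   Context: A quadratic form on $V$ is a map $f\colon V\to\mathbb{F}$ with $f(\lambda v)=\lambda^2f(v)$ for $\lambda\in\mathbb{F}$, $v\in V$, and such that $(v\mid w)=f(v+w)-f(v)-f(w)$ is a bilinear form on $V$. It is nondegenerate if $(v\mid V)=(0)$ implies $v=0$. The Clifford algebra $\mathrm{Cl}(V,f)$ is the associative algebra generated by the vector space $V$ and the identity element $1$ with defining relations $v^2=f(v)\cdot 1$ for all $v\in V$. A linear transformation $\varphi\colon V\to V$ is orthogonal if $f(\varphi(v))=f(v)$ for all $v\in V$. Its unique extension to a unital algebra homomorphism $\mathrm{Cl}(V)\to\mathrm{Cl}(V)$ is denoted $[\varphi]$ and called the Bogolyubov automorphism; it is an automorphism when $\varphi$ is bijective. It is inner if there is an invertible $x\in\mathrm{Cl}(V)$ with $[\varphi](a)=x^{-1}ax$ for all $a\in\mathrm{Cl}(V)$. A linear transformation $\psi\colon V\to V$ is finitary if $\ker(\psi-\mathrm{Id})$ has finite codimension in $V$. Thus $\varphi$ is finitary iff $V(1)$ has finite codimension, and $-\varphi$ is finitary iff $V(-1)$ has finite codimension. For a $\varphi$-invariant subspace $W\subset V$ of finite codimension, $\varphi|_{V/W}$ denotes the linear transformation induced by $\varphi$ on the finite-dimensional quotient $V/W$. *)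

(* Defs.v *)
From HB Require Import structures.
From mathcomp Require Import all_boot all_order all_algebra.
From mathcomp Require Import generic_quotient ring_quotient.
From mathcomp Require Import boolp classical_sets.

Set Implicit Arguments.
Unset Strict Implicit.
Unset Printing Implicit Defensive.

Import GRing.Theory.
Local Open Scope ring_scope.
Local Open Scope quotient_scope.

Section QuadraticForms.
Variables (F : fieldType) (V : lmodType F).

Definition polar (f : V -> F) (v w : V) : F := f (v + w) - f v - f w.

Record quadratic_form (f : V -> F) : Prop := QuadraticForm {
  quadratic_formZ : forall (a : F) (v : V), f (a *: v) = a ^+ 2 * f v;
  polar_linearr : forall v : V, scalar (polar f v);
  polar_linearl : forall w : V, scalar ((polar f)^~ w) }.

Definition quad_nondegenerate (f : V -> F) : Prop :=
  forall v : V, (forall w : V, polar f v w = 0) -> v = 0.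

Definition orthogonal_map (f : V -> F) (phi : V -> V) : Prop :=
  forall v : V, f (phi v) = f v.

End QuadraticForms.

(* [Cl f] is given by its presentation: formal noncommutative expressions in
   scalars and vectors, modulo the smallest congruence [cl_eq f] that makes
   them a unital associative F-algebra, makes [ClVec] linear, and imposes
   v ^ 2 = f v.  It makes sense for any function [f]. *)
Inductive cl_term (F V : Type) : Type :=
| ClScal of F
| ClVec of V
| ClAdd of cl_term F V & cl_term F V
| ClMul of cl_term F V & cl_term F V.
Arguments ClScal {F V}.
Arguments ClVec {F V}.

HB.instance Definition _ (F V : Type) := gen_eqMixin (cl_term F V).
HB.instance Definition _ (F V : Type) := gen_choiceMixin (cl_term F V).

Section Clifford.
Variables (F : fieldType) (V : lmodType F) (f : V -> F).
Local Notation T := (cl_term F V).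

Inductive cl_eq : T -> T -> Prop :=
| cl_refl x : cl_eq x x
| cl_sym x y : cl_eq x y -> cl_eq y x
| cl_trans y x z : cl_eq x y -> cl_eq y z -> cl_eq x z
| cl_congrD x x' y y' :
    cl_eq x x' -> cl_eq y y' -> cl_eq (ClAdd x y) (ClAdd x' y')
| cl_congrM x x' y y' :
    cl_eq x x' -> cl_eq y y' -> cl_eq (ClMul x y) (ClMul x' y')
| cl_addA x y z : cl_eq (ClAdd x (ClAdd y z)) (ClAdd (ClAdd x y) z)
| cl_addC x y : cl_eq (ClAdd x y) (ClAdd y x)
| cl_add0 x : cl_eq (ClAdd (ClScal 0) x) x
| cl_addN x : cl_eq (ClAdd (ClMul (ClScal (-1)) x) x) (ClScal 0)
| cl_mulA x y z : cl_eq (ClMul x (ClMul y z)) (ClMul (ClMul x y) z)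
| cl_mul1 x : cl_eq (ClMul (ClScal 1) x) x
| cl_mulDl x y z :
    cl_eq (ClMul (ClAdd x y) z) (ClAdd (ClMul x z) (ClMul y z))
| cl_mulDr x y z :
    cl_eq (ClMul x (ClAdd y z)) (ClAdd (ClMul x y) (ClMul x z))
| cl_scalD a b : cl_eq (ClScal (a + b)) (ClAdd (ClScal a) (ClScal b))
| cl_scalM a b : cl_eq (ClScal (a * b)) (ClMul (ClScal a) (ClScal b))
| cl_scalC a x : cl_eq (ClMul (ClScal a) x) (ClMul x (ClScal a))
| cl_vecD u v : cl_eq (ClVec (u + v)) (ClAdd (ClVec u) (ClVec v))
| cl_vecZ a v : cl_eq (ClVec (a *: v)) (ClMul (ClScal a) (ClVec v))
| cl_vec2 v : cl_eq (ClMul (ClVec v) (ClVec v)) (ClScal (f v)).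

Definition cl_eqb (x y : T) : bool := `[< cl_eq x y >].

Lemma cl_eqb_equiv : equiv_class_of cl_eqb.
Proof.
split=> [x|x y|y x z].
- exact/asboolP/cl_refl.
- by apply/asboolP/asboolP; apply: cl_sym.
- by move=> /asboolP xy /asboolP yz; apply/asboolP/(cl_trans xy yz).
Qed.

Canonical cl_eqb_equivRel := EquivRelPack cl_eqb_equiv.
Canonical cl_eqb_encModRel := defaultEncModRel cl_eqb.

Definition Cl : Type := {eq_quot cl_eqb}.
HB.instance Definition _ := Choice.on Cl.
HB.instance Definition _ : EqQuotient T cl_eqb Cl := EqQuotient.on Cl.

Definition clpi (x : T) : Cl := \pi_Cl x.

Lemma clpiP x y : clpi x = clpi y <-> cl_eq x y.
Proof. by split=> [/eqmodP/asboolP|xy] //; apply/eqmodP/asboolP. Qed.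

Lemma clpi_repr (x : Cl) : clpi (repr x) = x.
Proof. exact: reprK. Qed.

Lemma clpi_ind (P : Cl -> Prop) : (forall x, P (clpi x)) -> forall x, P x.
Proof. by move=> Pp x; rewrite -[x]clpi_repr. Qed.

Definition cl_add (x y : Cl) : Cl := clpi (ClAdd (repr x) (repr y)).
Definition cl_mul (x y : Cl) : Cl := clpi (ClMul (repr x) (repr y)).
Definition cl_scal (a : F) : Cl := clpi (ClScal a).
Definition cl_opp (x : Cl) : Cl := cl_mul (cl_scal (-1)) x.
Definition cl_scale (a : F) (x : Cl) : Cl := cl_mul (cl_scal a) x.

Lemma cl_repr_pi x : cl_eq (repr (clpi x)) x.
Proof. by apply/clpiP; rewrite clpi_repr. Qed.

Lemma cl_addE x y : cl_add (clpi x) (clpi y) = clpi (ClAdd x y).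
Proof. by apply/clpiP/cl_congrD; apply: cl_repr_pi. Qed.

Lemma cl_mulE x y : cl_mul (clpi x) (clpi y) = clpi (ClMul x y).
Proof. by apply/clpiP/cl_congrM; apply: cl_repr_pi. Qed.

Let clE := (cl_addE, cl_mulE).

Fact cl_addrA : associative cl_add.
Proof.
by elim/clpi_ind=> x; elim/clpi_ind=> y; elim/clpi_ind=> z;
  rewrite !clE; apply/clpiP/cl_addA.
Qed.

Fact cl_addrC : commutative cl_add.
Proof.
by elim/clpi_ind=> x; elim/clpi_ind=> y; rewrite !clE; apply/clpiP/cl_addC.
Qed.

Fact cl_add0r : left_id (cl_scal 0) cl_add.
Proof. by elim/clpi_ind=> x; rewrite !clE; apply/clpiP/cl_add0. Qed.

Fact cl_addNr : left_inverse (cl_scal 0) cl_opp cl_add.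
Proof.
by elim/clpi_ind=> x; rewrite /cl_opp cl_mulE cl_addE; apply/clpiP/cl_addN.
Qed.

HB.instance Definition _ :=
  GRing.isZmodule.Build Cl cl_addrA cl_addrC cl_add0r cl_addNr.

Fact cl_mulrA : associative cl_mul.
Proof.
by elim/clpi_ind=> x; elim/clpi_ind=> y; elim/clpi_ind=> z;
  rewrite !clE; apply/clpiP/cl_mulA.
Qed.

Fact cl_mul1r : left_id (cl_scal 1) cl_mul.
Proof. by elim/clpi_ind=> x; rewrite !clE; apply/clpiP/cl_mul1. Qed.

Fact cl_mulr1 : right_id (cl_scal 1) cl_mul.
Proof.
elim/clpi_ind=> x; rewrite !clE; apply/clpiP.
by apply: cl_trans (cl_mul1 x); apply/cl_sym/cl_scalC.
Qed.

Fact cl_mulrDl : left_distributive cl_mul +%R.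
Proof.
by elim/clpi_ind=> x; elim/clpi_ind=> y; elim/clpi_ind=> z;
  rewrite /GRing.add /= !clE; apply/clpiP/cl_mulDl.
Qed.

Fact cl_mulrDr : right_distributive cl_mul +%R.
Proof.
by elim/clpi_ind=> x; elim/clpi_ind=> y; elim/clpi_ind=> z;
  rewrite /GRing.add /= !clE; apply/clpiP/cl_mulDr.
Qed.

(* Not an [algType], because that interface demands 1 != 0, which holds for
   quadratic forms but not for an arbitrary function [f]. *)
HB.instance Definition _ := GRing.Zmodule_isPzRing.Build Cl
  cl_mulrA cl_mul1r cl_mulr1 cl_mulrDl cl_mulrDr.

Lemma clpiD x y : clpi (ClAdd x y) = clpi x + clpi y.
Proof. by rewrite -cl_addE. Qed.

Lemma clpiM x y : clpi (ClMul x y) = clpi x * clpi y.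
Proof. by rewrite -cl_mulE. Qed.

Fact cl_scal_is_zmod_morphism : zmod_morphism cl_scal.
Proof.
move=> a b; apply/(canRL (addrK (cl_scal b))).
by rewrite -clpiD; apply/clpiP; rewrite -{2}(subrK b a); apply/cl_sym/cl_scalD.
Qed.

HB.instance Definition _ :=
  GRing.isZmodMorphism.Build F Cl cl_scal cl_scal_is_zmod_morphism.

Fact cl_scal_is_monoid_morphism : monoid_morphism cl_scal.
Proof. by split=> // a b; rewrite -clpiM; apply/clpiP/cl_scalM. Qed.

HB.instance Definition _ :=
  GRing.isMonoidMorphism.Build F Cl cl_scal cl_scal_is_monoid_morphism.

Lemma cl_scal_central a (x : Cl) : cl_scal a * x = x * cl_scal a.
Proof.
by elim/clpi_ind: x => x; rewrite -!clpiM; apply/clpiP/cl_scalC.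
Qed.

Fact cl_scaleA a b x : cl_scale a (cl_scale b x) = cl_scale (a * b) x.
Proof.
change (cl_scal a * (cl_scal b * x) = cl_scal (a * b) * x).
by rewrite rmorphM mulrA.
Qed.

Fact cl_scale1 : left_id 1 cl_scale.
Proof. exact: cl_mul1r. Qed.

Fact cl_scaleDr : right_distributive cl_scale +%R.
Proof. by move=> a x y; apply: mulrDr. Qed.

Fact cl_scaleDl x : {morph cl_scale^~ x : a b / a + b}.
Proof.
move=> a b; change (cl_scal (a + b) * x = cl_scal a * x + cl_scal b * x).
by rewrite rmorphD mulrDl.
Qed.

HB.instance Definition _ := GRing.Zmodule_isLmodule.Build F Cl
  cl_scaleA cl_scale1 cl_scaleDr cl_scaleDl.

Lemma cl_scaleE a (x : Cl) : a *: x = cl_scal a * x.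
Proof. by []. Qed.

Lemma cl_scalerAl a (x y : Cl) : a *: (x * y) = (a *: x) * y.
Proof. by rewrite !cl_scaleE mulrA. Qed.

Lemma cl_scalerAr a (x y : Cl) : a *: (x * y) = x * (a *: y).
Proof. by rewrite !cl_scaleE !mulrA cl_scal_central. Qed.

Definition cl_vec (v : V) : Cl := clpi (ClVec v).

Fact cl_vec_is_linear : linear cl_vec.
Proof.
move=> a u v; rewrite cl_scaleE -clpiM -clpiD; apply/clpiP.
apply: cl_trans (cl_vecD _ _) _; apply: cl_congrD (cl_refl _).
exact: cl_vecZ.
Qed.

HB.instance Definition _ :=
  GRing.isLinear.Build F V Cl *:%R cl_vec cl_vec_is_linear.

Lemma cl_vec_sqr v : cl_vec v * cl_vec v = cl_scal (f v).
Proof. by rewrite -clpiM; apply/clpiP/cl_vec2. Qed.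

Lemma cl_ind (P : Cl -> Prop) :
    (forall a, P (cl_scal a)) -> (forall v, P (cl_vec v)) ->
    (forall x y, P x -> P y -> P (x + y)) ->
    (forall x y, P x -> P y -> P (x * y)) ->
  forall x, P x.
Proof.
move=> Ps Pv PD PM; elim/clpi_ind.
elim=> [a|v|x Px y Py|x Px y Py].
- exact: Ps.
- exact: Pv.
- by rewrite clpiD; apply: PD.
- by rewrite clpiM; apply: PM.
Qed.

End Clifford.

Arguments cl_scal {F V} f a.
Arguments cl_vec {F V} f v.

(* The universal property.  The target is a ring [A] made into an F-algebra by
   the central homomorphism [h], so that [A := Cl f'] is allowed. *)
Section CliffordLift.
Variables (F : fieldType) (V : lmodType F) (f : V -> F).
Variables (A : pzRingType) (h : {rmorphism F -> A}) (g : {additive V -> A}).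

Fixpoint cl_eval (x : cl_term F V) : A :=
  match x with
  | ClScal a => h a
  | ClVec v => g v
  | ClAdd x y => cl_eval x + cl_eval y
  | ClMul x y => cl_eval x * cl_eval y
  end.

Record cl_compatible : Prop := ClCompatible {
  cl_compatC : forall a x, h a * x = x * h a;
  cl_compatZ : forall a v, g (a *: v) = h a * g v;
  cl_compat2 : forall v, g v * g v = h (f v) }.

Hypothesis hg : cl_compatible.

Lemma cl_evalP x y : cl_eq f x y -> cl_eval x = cl_eval y.
Proof.
case: hg => hC gZ g2.
elim=> //=.
- by move=> ? ? ? _ -> _ ->.
- by move=> ? ? ? ? _ -> _ ->.
- by move=> ? ? ? ? _ -> _ ->.
- by move=> ? ? ?; rewrite addrA.
- by move=> ? ?; rewrite addrC.
- by move=> ?; rewrite rmorph0 add0r.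
- by move=> ?; rewrite rmorphN1 mulN1r addNr rmorph0.
- by move=> ? ? ?; rewrite mulrA.
- by move=> ?; rewrite rmorph1 mul1r.
- by move=> ? ? ?; rewrite mulrDl.
- by move=> ? ? ?; rewrite mulrDr.
- by move=> ? ?; rewrite rmorphD.
- by move=> ? ?; rewrite rmorphM.
- by move=> ? ?; rewrite raddfD.
Qed.

Definition cl_lift_fun of cl_compatible := fun x : Cl f => cl_eval (repr x).
Local Notation lift := (cl_lift_fun hg).

Lemma cl_lift_fun_pi x : lift (clpi f x) = cl_eval x.
Proof. exact/cl_evalP/cl_repr_pi. Qed.

Fact cl_lift_is_zmod_morphism : zmod_morphism lift.
Proof.
move=> x y; apply/(canRL (addrK (lift y))).
rewrite -[in RHS](subrK y x).
elim/clpi_ind: (x - y) => z; elim/clpi_ind: y => y.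
by rewrite -clpiD !cl_lift_fun_pi.
Qed.

HB.instance Definition _ :=
  GRing.isZmodMorphism.Build (Cl f) A lift cl_lift_is_zmod_morphism.

Fact cl_lift_is_monoid_morphism : monoid_morphism lift.
Proof.
split=> [|x y]; first by rewrite cl_lift_fun_pi /= rmorph1.
elim/clpi_ind: x => x; elim/clpi_ind: y => y.
by rewrite -clpiM !cl_lift_fun_pi.
Qed.

HB.instance Definition _ :=
  GRing.isMonoidMorphism.Build (Cl f) A lift cl_lift_is_monoid_morphism.

Definition cl_lift : {rmorphism Cl f -> A} := lift.

Lemma cl_lift_scal a : cl_lift (cl_scal f a) = h a.
Proof. exact: cl_lift_fun_pi. Qed.

Lemma cl_lift_vec v : cl_lift (cl_vec f v) = g v.
Proof. exact: cl_lift_fun_pi. Qed.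

Lemma cl_lift_unique (k : {rmorphism Cl f -> A}) :
    (forall a, k (cl_scal f a) = h a) -> (forall v, k (cl_vec f v) = g v) ->
  k =1 cl_lift.
Proof.
move=> ks kv; elim/cl_ind => [a|v|x y IHx IHy|x y IHx IHy].
- by rewrite ks cl_lift_scal.
- by rewrite kv cl_lift_vec.
- by rewrite !rmorphD IHx IHy.
- by rewrite !rmorphM IHx IHy.
Qed.

End CliffordLift.

Section Bogolyubov.
Variables (F : fieldType) (V : lmodType F) (f : V -> F).

Lemma bogolyubov_compatible (phi : {linear V -> V}) :
  orthogonal_map f phi ->
  cl_compatible f (cl_scal f) (cl_vec f \o phi).
Proof.
move=> fphi; split=> [a x|a v|v] /=; first exact: cl_scal_central.
  by rewrite !linearZ.
by rewrite cl_vec_sqr fphi.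
Qed.

Definition bogolyubov (phi : {linear V -> V}) (fphi : orthogonal_map f phi) :
    {rmorphism Cl f -> Cl f} :=
  cl_lift (bogolyubov_compatible fphi).

Lemma bogolyubov_vec (phi : {linear V -> V}) (fphi : orthogonal_map f phi) v :
  bogolyubov fphi (cl_vec f v) = cl_vec f (phi v).
Proof. exact: cl_lift_vec. Qed.

Lemma bogolyubovZ (phi : {linear V -> V}) (fphi : orthogonal_map f phi) a x :
  bogolyubov fphi (a *: x) = a *: bogolyubov fphi x.
Proof. by rewrite !cl_scaleE rmorphM [X in X * _]cl_lift_scal. Qed.

End Bogolyubov.

Definition inner (A : pzRingType) (s : A -> A) : Prop :=
  exists x y : A, [/\ x * y = 1, y * x = 1 & forall a, s a = y * a * x].

Section LinearAlgebra.
Variable F : fieldType.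

Section Basis.
Variable U : lmodType F.

Definition is_basis k (e : 'I_k -> U) : Prop :=
  (forall c : 'I_k -> F, \sum_i c i *: e i = 0 -> forall i, c i = 0) /\
  (forall u, exists c : 'I_k -> F, u = \sum_i c i *: e i).

Definition has_dim (k : nat) : Prop := exists e : 'I_k -> U, is_basis e.

Definition finite_dim : Prop := exists k, has_dim k.

Definition is_mx_of (psi : U -> U) k (e : 'I_k -> U) (M : 'M[F]_k) : Prop :=
  forall i, psi (e i) = \sum_j M i j *: e j.

(* Equal to 1 when [U] has no finite basis; by [lin_detE] below, the choice of
   the basis is irrelevant otherwise. *)
Definition lin_det (psi : {linear U -> U}) : F :=
  xget 1 [set d | exists k (e : 'I_k -> U) (M : 'M[F]_k),
                    [/\ is_basis e, is_mx_of psi e M & d = \det M]].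

Lemma basis_change k l (e : 'I_k -> U) (e' : 'I_l -> U) : is_basis e' ->
  exists P : 'M[F]_(k, l), forall i, e i = \sum_j P i j *: e' j.
Proof.
move=> [_ e'span]; have /choice[c ec] := fun i => e'span (e i).
by exists (\matrix_(i, j) c i j) => i; rewrite ec; under [RHS]eq_bigr do rewrite mxE.
Qed.

Lemma mulmx_family k l m (e : 'I_m -> U) (P : 'M[F]_(k, l)) (Q : 'M[F]_(l, m)) i :
  \sum_j P i j *: (\sum_n Q j n *: e n) = \sum_n (P *m Q) i n *: e n.
Proof.
under eq_bigr do rewrite scaler_sumr.
rewrite exchange_big /=; apply: eq_bigr => n _.
by rewrite mxE scaler_suml; apply: eq_bigr => j _; rewrite scalerA.
Qed.

Lemma basis_mx_inj k l (e : 'I_l -> U) (P Q : 'M[F]_(k, l)) : is_basis e ->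
  (forall i, \sum_j P i j *: e j = \sum_j Q i j *: e j) -> P = Q.
Proof.
move=> [efree _] PQ; apply/matrixP => i j; apply/eqP; rewrite -subr_eq0; apply/eqP.
apply: (efree (fun j => P i j - Q i j)); under eq_bigr do rewrite scalerBl.
by rewrite sumrB PQ subrr.
Qed.

Lemma basis_changeK k l (e : 'I_k -> U) (e' : 'I_l -> U)
    (P : 'M[F]_(k, l)) (Q : 'M[F]_(l, k)) : is_basis e ->
    (forall i, e i = \sum_j P i j *: e' j) ->
    (forall i, e' i = \sum_j Q i j *: e j) ->
  P *m Q = 1%:M.
Proof.
move=> eb eP e'Q; apply: (basis_mx_inj eb) => i.
rewrite -mulmx_family; under eq_bigr do rewrite -e'Q.
rewrite -eP (bigD1 i) //= mxE eqxx scale1r big1 ?addr0 // => j ji.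
by rewrite mxE eq_sym (negPf ji) scale0r.
Qed.

Lemma has_dim_unique k l : has_dim k -> has_dim l -> k = l.
Proof.
suff le m n : has_dim m -> has_dim n -> (m <= n)%N.
  by move=> hk hl; apply/eqP; rewrite eqn_leq !le.
move=> [e eb] [e' e'b].
have [P eP] := basis_change e e'b; have [Q e'Q] := basis_change e' eb.
rewrite -(mxrank1 F m) -(basis_changeK eb eP e'Q).
exact: leq_trans (mxrankM_maxl _ _) (rank_leq_col _).
Qed.

Lemma lin_detE (psi : {linear U -> U}) k (e : 'I_k -> U) (M : 'M[F]_k) :
  is_basis e -> is_mx_of psi e M -> lin_det psi = \det M.
Proof.
move=> eb eM; rewrite /lin_det; case: xgetP => [d _|]; last first.
  by move=> /(_ (\det M)) []; exists k, e, M.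
move=> [l [e' [M' [e'b e'M' ->]]]].
have lk : l = k by apply: has_dim_unique; [exists e' | exists e].
subst l.
have [P eP] := basis_change e e'b; have [Q e'Q] := basis_change e' eb.
have PQ := basis_changeK eb eP e'Q.
have MP : M *m P = P *m M'.
  apply: (basis_mx_inj e'b) => i; rewrite -!mulmx_family.
  under eq_bigr do rewrite -eP.
  under [RHS]eq_bigr do rewrite -e'M'.
  rewrite -eM eP linear_sum; apply: eq_bigr => j _.
  by rewrite linearZ.
have -> : M = P *m M' *m Q by rewrite -MP -mulmxA PQ mulmx1.
rewrite !det_mulmx mulrAC -det_mulmx PQ det1 mul1r.
by [].
Qed.

Lemma is_mx_of_exists (psi : U -> U) k (e : 'I_k -> U) : is_basis e ->
  exists M, is_mx_of psi e M.
Proof. exact: basis_change. Qed.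

End Basis.

Section QuotientSpace.
Variables (V : lmodType F) (W : submodClosed V).

(* [submodClosed] does not inherit from [zmodClosed], which [{ideal_quot _}]
   requires. *)
Definition submod_pred : {pred V} := W.

Fact submod_pred_zmod_closed : zmod_closed submod_pred.
Proof. exact: GRing.submod_closedB (submodClosedP W). Qed.

HB.instance Definition _ :=
  GRing.isZmodClosed.Build V submod_pred submod_pred_zmod_closed.

Definition quot_space : Type := {ideal_quot submod_pred}.
HB.instance Definition _ := GRing.Zmodule.on quot_space.

Definition quot_proj (v : V) : quot_space := \pi_({ideal_quot submod_pred}) v.

Lemma quot_projP u v : quot_proj u = quot_proj v <-> u - v \in W.
Proof.
rewrite -[_ \in W]/(u - v \in submod_pred) Quotient.idealrBE.
by split=> [uv|/eqP]; first exact/eqP.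
Qed.

Lemma quot_repr_proj v : repr (quot_proj v) - v \in W.
Proof. by apply/quot_projP; rewrite /quot_proj reprK. Qed.

Lemma quot_ind (P : quot_space -> Prop) :
  (forall v, P (quot_proj v)) -> forall x, P x.
Proof. by move=> Pp x; rewrite -[x]reprK; apply: Pp. Qed.

Fact quot_proj_is_zmod_morphism : zmod_morphism quot_proj.
Proof. by move=> u v; rewrite /quot_proj !piE. Qed.

HB.instance Definition _ :=
  GRing.isZmodMorphism.Build V quot_space quot_proj quot_proj_is_zmod_morphism.

Definition quot_scale (a : F) (x : quot_space) : quot_space :=
  quot_proj (a *: repr x).

Lemma quot_scaleE a v : quot_scale a (quot_proj v) = quot_proj (a *: v).
Proof. by apply/quot_projP; rewrite -scalerBr rpredZ ?quot_repr_proj. Qed.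

Fact quot_scaleA a b x : quot_scale a (quot_scale b x) = quot_scale (a * b) x.
Proof. by elim/quot_ind: x => v; rewrite !quot_scaleE scalerA. Qed.

Fact quot_scale1 : left_id 1 quot_scale.
Proof. by elim/quot_ind=> v; rewrite quot_scaleE scale1r. Qed.

Fact quot_scaleDr : right_distributive quot_scale +%R.
Proof.
move=> a; elim/quot_ind=> u; elim/quot_ind=> v.
by rewrite -raddfD !quot_scaleE scalerDr raddfD.
Qed.

Fact quot_scaleDl x : {morph quot_scale^~ x : a b / a + b}.
Proof.
by elim/quot_ind: x => v a b; rewrite !quot_scaleE scalerDl raddfD.
Qed.

HB.instance Definition _ := GRing.Zmodule_isLmodule.Build F quot_space
  quot_scaleA quot_scale1 quot_scaleDr quot_scaleDl.

Fact quot_proj_is_scalable : scalable quot_proj.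
Proof. by move=> a v; rewrite [RHS]quot_scaleE. Qed.

HB.instance Definition _ :=
  GRing.isScalable.Build F V quot_space *:%R quot_proj quot_proj_is_scalable.

Variable phi : {linear V -> V}.

Definition quot_map_fun of {homo phi : v / v \in W} :=
  fun x : quot_space => quot_proj (phi (repr x)).

Hypothesis phiW : {homo phi : v / v \in W}.

Lemma quot_map_fun_proj v :
  quot_map_fun phiW (quot_proj v) = quot_proj (phi v).
Proof. by apply/quot_projP; rewrite -linearB phiW ?quot_repr_proj. Qed.

Fact quot_map_is_linear : linear (quot_map_fun phiW).
Proof.
move=> a; elim/quot_ind=> u; elim/quot_ind=> v.
by rewrite -linearP !quot_map_fun_proj -linearP -linearP.
Qed.

HB.instance Definition _ := GRing.isLinear.Build F quot_space quot_space *:%R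
  (quot_map_fun phiW) quot_map_is_linear.

Definition quot_map : {linear quot_space -> quot_space} := quot_map_fun phiW.

Lemma quot_map_proj v : quot_map (quot_proj v) = quot_proj (phi v).
Proof. exact: quot_map_fun_proj. Qed.

End QuotientSpace.

Section Kernel.
Variables (U V : lmodType F) (g : {linear U -> V}).

Definition kernel : {pred U} := fun v => g v == 0.

Fact kernel_submod_closed : submod_closed kernel.
Proof.
split=> [|a u v]; rewrite !unfold_in ?linear0 //.
by move=> /eqP gu /eqP gv; rewrite linearP gu gv scaler0 addr0.
Qed.

HB.instance Definition _ :=
  GRing.isSubmodClosed.Build F U kernel kernel_submod_closed.

End Kernel.

Section Eigenspaces.
Variables (V : lmodType F) (phi : {linear V -> V}).

Definition eigen (a : F) : submodClosed V := kernel (phi \- a \*: idfun).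

Lemma eigenP a v : reflect (phi v = a *: v) (v \in eigen a).
Proof. by rewrite unfold_in /= subr_eq0; apply: eqP. Qed.

Lemma eigen_stable a : {homo phi : v / v \in eigen a}.
Proof. by move=> v /eigenP phiv; apply/eigenP; rewrite phiv linearZ /= phiv. Qed.

Definition quot_eigen (a : F) :
    {linear quot_space (eigen a) -> quot_space (eigen a)} :=
  quot_map (@eigen_stable a).

Definition finitary : Prop := finite_dim (quot_space (kernel (phi \- idfun))).

End Eigenspaces.

End LinearAlgebra.

(* Main.v *)
Require Import Defs.
From HB Require Import structures.
From mathcomp Require Import all_boot all_order all_algebra.
From mathcomp Require Import ring boolp.

(* Let a = 1 or a = -1.  If a phi is a product of n reflections in nonisotropic
   vectors u_i, then conjugation by x = u_1 ... u_n is (-1)^n a phi on V, and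
   det (a phi) = (-1)^n; so [phi] is inner as soon as (-1)^n = a.  If a phi is
   finitary, it is such a product.

   Conversely let x conjugate V by phi, and let p, q be x plus or minus its
   image under the grading.  Both are generated by some finite-dimensional
   nondegenerate U, and for w orthogonal to U one gets p (phi w - w) = 0 and
   q (phi w + w) = 0.  A nonzero element generated by U annihilates on the right
   only vectors of U, so phi or -phi is finitary, and exactly one of p, q
   vanishes: x is homogeneous of parity a, and a phi is a product of n
   reflections, implemented by y of parity n.  If the parities differed, z = x / y
   would be odd and anticommute with V, i.e. be central in the graded sense; then
   z is a scalar, so z = 0, which is absurd as Cl(V) is not trivial. *)

Set Implicit Arguments.
Unset Strict Implicit.
Unset Printing Implicit Defensive.

Import GRing.Theory.
Local Open Scope ring_scope.

(** * Determinants, spanning families and quotient spaces *)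

(** Sylvester's determinant identity: a unipotent block matrix conjugates one block triangular
    matrix into another. *)
Lemma det1_mulmxC (R : comNzRingType) m n (P : 'M[R]_(m, n)) (Q : 'M[R]_(n, m)) :
  \det (1%:M + P *m Q) = \det (1%:M + Q *m P).
Proof.
have : block_mx (1%:M + P *m Q) (- P) 0 1%:M *m block_mx 1%:M 0 Q 1%:M =
       block_mx 1%:M 0 Q 1%:M *m block_mx 1%:M (- P) 0 (1%:M + Q *m P).
  rewrite !mulmx_block !(mul1mx, mulmx1, mul0mx, mulmx0, addr0, add0r).
  by rewrite mulNmx mulmxN addrK addrCA addNr addr0.
move/(congr1 determinant); rewrite !det_mulmx !(det_ublock, det_lblock) !det1.
by rewrite !(mulr1, mul1r).
Qed.

(** A relation with [c i] nonzero expresses [g i] through the other vectors, whence induction on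
    [n]. *)
Lemma spanned_finite_dim (F : fieldType) (U : lmodType F) n (g : 'I_n -> U) :
    (forall u, exists c : 'I_n -> F, u = \sum_i c i *: g i) ->
  finite_dim U.
Proof.
elim: n g => [|n IHn] g gspan; first by exists 0%N, g; split=> // c _ [].
have [gfree|/existsNP[c /not_implyP[cg /existsNP[i /eqP ci]]]] :=
  EM (forall c : 'I_n.+1 -> F, \sum_i c i *: g i = 0 -> forall i, c i = 0).
  by exists n.+1, g.
apply: (IHn (g \o lift i)) => u; have [d ->] := gspan u.
exists (fun j => d (lift i j) - d i * c (lift i j) / c i).
move: cg; rewrite !(bigD1_ord i) //= => /eqP; rewrite addr_eq0 => /eqP cg.
under [RHS]eq_bigr do rewrite scalerBl.
rewrite sumrB addrC; congr (_ + _).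
rewrite -[g i](scalerK ci) cg scalerA scalerN scaler_sumr; congr (- _).
by apply: eq_bigr => j _; rewrite scalerA mulrAC.
Qed.

(** Submodules with the same elements may still give different quotient types, so a basis is carried
    over through representatives. *)
Lemma has_dim_quot_eq (F : fieldType) (V : lmodType F) (W W' : submodClosed V) k :
  W =i W' -> has_dim (quot_space W) k -> has_dim (quot_space W') k.
Proof.
move=> WW' [b [bfree bspan]].
have bE i : b i = quot_proj W (repr (b i)) by rewrite /quot_proj reprK.
have comb (X : submodClosed V) (c : 'I_k -> F) :
    \sum_i c i *: quot_proj X (repr (b i)) = quot_proj X (\sum_i c i *: repr (b i)).
  by rewrite linear_sum; apply: eq_bigr => i _; rewrite linearZ.
have proj0 (X : submodClosed V) v : quot_proj X v = 0 <-> v \in X.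
  by rewrite -[0](linear0 (quot_proj X)) quot_projP subr0.
exists (fun i => quot_proj W' (repr (b i))); split=> [c|].
  rewrite comb => /proj0; rewrite -WW' => /proj0; rewrite -comb => c0.
  by apply: bfree; rewrite -[RHS]c0; apply: eq_bigr => i _; rewrite -bE.
elim/quot_ind => v; have [c] := bspan (quot_proj W v).
under eq_bigr do rewrite bE.
by rewrite comb => /quot_projP; rewrite WW' => /quot_projP vc; exists c; rewrite comb.
Qed.

(** * Polar forms of quadratic forms *)

Section QuadraticSpace.
Variables (F : fieldType) (V : lmodType F) (f : V -> F).
Hypotheses (charF : 2%N \notin [pchar F]) (quadf : quadratic_form f).
Implicit Types (a b : F) (u v w x y : V) (e l us : seq V).

Local Notation B := (polar f).

Lemma two_neq0 : (2%:R : F) != 0.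
Proof. by move: charF; rewrite inE /=. Qed.

Lemma polarC u v : B u v = B v u.
Proof. by rewrite /polar (addrC u) addrAC. Qed.

Lemma polarDr u v w : B u (v + w) = B u v + B u w.
Proof. by have := polar_linearr quadf u 1 v w; rewrite scale1r mul1r. Qed.

Lemma polar0r u : B u 0 = 0.
Proof. by apply: (addrI (B u 0)); rewrite -polarDr !addr0. Qed.

Lemma polarZr u a v : B u (a *: v) = a * B u v.
Proof. by have := polar_linearr quadf u a v 0; rewrite addr0 polar0r addr0. Qed.

Lemma polarBr u v w : B u (v - w) = B u v - B u w.
Proof. by rewrite polarDr -scaleN1r polarZr mulN1r. Qed.

Lemma polarDl u v w : B (u + v) w = B u w + B v w.
Proof. by rewrite !(polarC _ w) polarDr. Qed.

Lemma polarZl u a v : B (a *: u) v = a * B u v.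
Proof. by rewrite !(polarC _ v) polarZr. Qed.

Lemma polarBl u v w : B (u - v) w = B u w - B v w.
Proof. by rewrite !(polarC _ w) polarBr. Qed.

Lemma quadD u v : f (u + v) = f u + f v + B u v.
Proof. by rewrite /polar; ring. Qed.

Lemma quadB u v : f (u - v) = f u + f v - B u v.
Proof.
by rewrite quadD -scaleN1r polarZr (quadratic_formZ quadf); ring.
Qed.

Lemma polar_diag v : B v v = 2%:R * f v.
Proof.
rewrite /polar -mulr2n -scaler_nat (quadratic_formZ quadf); ring.
Qed.

Lemma polar_diag_eq0 v : (B v v == 0) = (f v == 0).
Proof. by rewrite polar_diag mulf_eq0 (negPf two_neq0). Qed.

Lemma polar_sum v (I : Type) (r : seq I) (g : I -> V) :
  B v (\sum_(i <- r) g i) = \sum_(i <- r) B v (g i).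
Proof.
by elim/big_rec2: _ => [|i _ ? _ <-]; rewrite ?polar0r ?polarDr.
Qed.

(** * Reflections *)

(** As [B u u] is twice [f u], for nonisotropic [u] this is the usual reflection in the hyperplane
    orthogonal to [u]. *)
Definition refl u v : V := v - (B u v / f u) *: u.

Lemma polar_refl u v w : f u != 0 -> B (refl u v) (refl u w) = B v w.
Proof.
move=> fu; rewrite /refl !(polarBl, polarBr, polarZl, polarZr) polar_diag.
by rewrite (polarC v u); field.
Qed.

Lemma reflK u : f u != 0 -> involutive (refl u).
Proof.
move=> fu v; rewrite {1}/refl {1}/refl polarBr polarZr polar_diag.
rewrite /refl -addrA -opprD -scalerDl.
have -> : B u v / f u + (B u v - B u v / f u * (2%:R * f u)) / f u = 0.
  by field.
by rewrite scale0r subr0.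
Qed.

Lemma refl_orth u v : B u v = 0 -> refl u v = v.
Proof. by rewrite /refl => ->; rewrite mul0r scale0r subr0. Qed.

Definition refls us v : V := foldr refl v us.

(** * Orthogonal families and projections *)

Definition orth e :=
  pairwise (fun x y => B x y == 0) e && all (fun x => f x != 0) e.

(** For [orth e] this is the orthogonal projection onto the span of [e]; the equation [proj e v = v]
    serves as membership of [v] in that span. *)
Definition proj e v : V := \sum_(x <- e) (B x v / B x x) *: x.

Lemma orth_cons x e :
  orth (x :: e) -> [/\ f x != 0, forall y, y \in e -> B x y = 0 & orth e].
Proof.
by case/andP=> /= /andP[/allP xe pe] /andP[fx qe]; split=> [//|y /xe/eqP//|]; apply/andP.
Qed.

Lemma consorth x e :
  f x != 0 -> (forall y, y \in e -> B x y = 0) -> orth e -> orth (x :: e).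
Proof.
move=> fx xe /andP[ep eq]; rewrite /orth /= fx ep eq !andbT.
by apply/allP=> y /xe ->.
Qed.

Lemma proj_cons x e v : proj (x :: e) v = (B x v / B x x) *: x + proj e v.
Proof. by rewrite /proj big_cons. Qed.

Lemma projD e v w : proj e (v + w) = proj e v + proj e w.
Proof.
rewrite /proj -big_split; apply: eq_bigr => x _.
by rewrite polarDr mulrDl scalerDl.
Qed.

Lemma projZ e a v : proj e (a *: v) = a *: proj e v.
Proof.
rewrite /proj scaler_sumr; apply: eq_bigr => x _.
by rewrite polarZr -mulrA scalerA.
Qed.

Lemma projB e v w : proj e (v - w) = proj e v - proj e w.
Proof. by rewrite projD -scaleN1r projZ scaleN1r. Qed.

Lemma proj_orth e v : (forall x, x \in e -> B x v = 0) -> proj e v = 0.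
Proof.
by move=> ev; rewrite /proj big1_seq // => x /andP[_ /ev->]; rewrite mul0r scale0r.
Qed.

Lemma polar_proj0 e v w : (forall x, x \in e -> B v x = 0) -> B v (proj e w) = 0.
Proof.
move=> ev; rewrite polar_sum big1_seq // => x /andP[_ /ev ex].
by rewrite polarZr ex mulr0.
Qed.

Lemma proj_mem e x : orth e -> x \in e -> proj e x = x.
Proof.
elim: e => // y e IHe /orth_cons[fy ye oe]; rewrite inE proj_cons.
case/predU1P=> [->|xe].
  rewrite divff ?polar_diag_eq0 // scale1r proj_orth ?addr0 // => z /ye.
  by rewrite polarC.
by rewrite ye // mul0r scale0r add0r IHe.
Qed.

Lemma polar_sub_proj e v x : orth e -> x \in e -> B x (v - proj e v) = 0.
Proof.
elim: e => // y e IHe /orth_cons[fy ye oe]; rewrite inE proj_cons.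
case/predU1P=> [->|xe].
  rewrite polarBr polarDr polar_proj0 // polarZr addr0.
  by rewrite divfK ?polar_diag_eq0 // subrr.
by rewrite opprD addrA addrAC polarBr IHe // polarZr (polarC x) (ye x) // mulr0 subr0.
Qed.

Lemma proj_idem e v : orth e -> proj e (proj e v) = proj e v.
Proof.
move=> oe; apply/eqP; rewrite eq_sym -subr_eq0 -projB proj_orth // => x xe.
exact: polar_sub_proj.
Qed.

Lemma polar_proj e v w : orth e -> B (proj e v) (w - proj e w) = 0.
Proof.
move=> oe; rewrite polarC polar_proj0 // => x xe.
by rewrite polarC polar_sub_proj.
Qed.

Lemma proj_sub_span e e' v :
  (forall x, x \in e -> proj e' x = x) -> proj e v = v -> proj e' v = v.
Proof.
move=> ee' <-; elim: e ee' => [|x e IHe] ee'.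
  by rewrite {2 3}/proj !big_nil proj_orth // => x _; rewrite polar0r.
rewrite proj_cons projD projZ ee' ?mem_head // IHe // => y ye.
by apply: ee'; rewrite inE ye orbT.
Qed.

Lemma orth_polar0 e x y :
  orth e -> x \in e -> y \in e -> x != y -> B x y = 0.
Proof.
elim: e => // z e IHe /orth_cons[_ ze oe]; rewrite !inE.
case/predU1P=> [->|xe] /predU1P[->|ye] xy; rewrite ?ze //.
- by rewrite eqxx in xy.
- by rewrite polarC ze.
- exact: IHe.
Qed.

(** * Isometries as products of reflections *)

Definition polar_preserving (psi : V -> V) := forall v w, B (psi v) (psi w) = B v w.

Lemma polar_preserving_quad psi v : polar_preserving psi -> f (psi v) = f v.
Proof.
move=> /(_ v v); rewrite !polar_diag; apply: mulfI; exact: two_neq0.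
Qed.

(** The displacement [psi v - v] lies in the span of [e] and is also orthogonal to [e], since [psi]
    fixes [e] and preserves the form. *)
Lemma polar_preserving_id e psi : orth e -> polar_preserving psi ->
    (forall v, proj e (psi v - v) = psi v - v) ->
    (forall x, x \in e -> psi x = x) ->
  forall v, psi v = v.
Proof.
move=> oe ipsi dpsi fpsi v; apply/subr0_eq; rewrite -dpsi proj_orth // => x xe.
by rewrite polarBr -{1}(fpsi x) // ipsi subrr.
Qed.

(* Weak Cartan-Dieudonne theorem: the members [x] of [e] are made fixed one by
   one, using the reflection in [psi x - x] or, if that vector is isotropic,
   the reflections in [psi x + x] and [x]. *)
Lemma polar_preserving_reflections e psi : orth e -> polar_preserving psi ->
    (forall v, proj e (psi v - v) = psi v - v) ->
  exists us, [/\ all (fun u => f u != 0) us,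
    forall u, u \in us -> proj e u = u & forall v, psi v = refls us v].
Proof.
move=> oe.
(* The induction is on [r], which contains the members of [e] that may still be moved. *)
move: psi; suff gen (r : seq V) psi : {subset r <= e} ->
    (forall x, x \in e -> x \notin r -> psi x = x) ->
    polar_preserving psi -> (forall v, proj e (psi v - v) = psi v - v) ->
  exists us, [/\ all (fun u => f u != 0) us,
    forall u, u \in us -> proj e u = u & forall v, psi v = refls us v].
  by move=> psi ipsi dpsi; apply: (gen e) => // x ->.
elim: r psi => [|x r IHr] psi re fixr ipsi dpsi.
  exists [::]; split=> // v.
  by apply: (polar_preserving_id oe ipsi dpsi) => x xe; apply: fixr.
have xe : x \in e by apply/re/mem_head.
have re' y : y \in r -> y \in e by move=> yr; apply: re; rewrite inE yr orbT.
have fx : f x != 0 by case/andP: oe => _ /allP/(_ x xe).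
have fpx : f (psi x) = f x by apply: polar_preserving_quad.
have step u q : f u != 0 -> proj e u = u -> polar_preserving q ->
    (forall v, proj e (q v - v) = q v - v) ->
  polar_preserving (refl u \o q) /\
    (forall v, proj e ((refl u \o q) v - v) = (refl u \o q) v - v).
  move=> fu ue iq dq; split=> [v w|v] /=; first by rewrite polar_refl.
  by rewrite /refl addrAC projB projZ ue dq.
(* The other fixed members of [e] are orthogonal to [x] and [psi x], so the reflections below do not
   move them. *)
have orthx y : y \in e -> y != x -> psi y = y -> B x y = 0 /\ B (psi x) y = 0.
  move=> ye yx yfix; rewrite -{2}yfix ipsi.
  by rewrite (@orth_polar0 e x y) // eq_sym.
have pxe : proj e (psi x) = psi x.
  by rewrite -[psi x](subrK x) projD dpsi (proj_mem oe xe).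
have fixed q : q x = x ->
    (forall y, psi y = y -> B x y = 0 -> B (psi x) y = 0 -> q y = y) ->
  forall y, y \in e -> y \notin r -> q y = y.
  move=> qx qy y ye yr; have [->//|yx] := eqVneq y x.
  have yfix : psi y = y by apply: fixr => //; rewrite inE negb_or yx.
  by have [xy pxy] := orthx _ ye yx yfix; apply: qy.
have [fu0|fu] := eqVneq (f (psi x - x)) 0; last first.
  have ue : proj e (psi x - x) = psi x - x by apply: dpsi.
  have [iq dq] := step _ _ fu ue ipsi dpsi.
  have [|us [us0 use qus]] := IHr _ re' _ iq dq.
    apply: fixed => [/=|y yfix xy pxy /=]; last first.
      by rewrite yfix refl_orth // polarBl pxy xy subrr.
    (* Since [f (psi x) = f x], the coefficient of the reflection is 1, and [psi x] goes to [x]. *)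
    have -> : refl (psi x - x) (psi x) = psi x - (psi x - x).
      rewrite /refl (_ : B _ _ = f (psi x - x)) ?divff ?scale1r //.
      by rewrite quadB polarBl polar_diag fpx (polarC x); ring.
    by rewrite opprB addrC subrK.
  exists (psi x - x :: us); split=> /= [|u|v]; first by rewrite fu.
    by rewrite inE => /predU1P[->|/use].
  by rewrite -qus /= reflK.
(* Parallelogram law: the values of [f] at [psi x + x] and [psi x - x] add up to four times
   [f x]. *)
have fu : f (psi x + x) != 0.
  have -> : f (psi x + x) = 2%:R * 2%:R * f x - f (psi x - x).
    by rewrite quadB quadD fpx; ring.
  by rewrite fu0 subr0 !mulf_neq0 ?two_neq0.
have ue : proj e (psi x + x) = psi x + x by rewrite projD pxe (proj_mem oe xe).
have [iq dq] := step _ _ fu ue ipsi dpsi.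
have [iq' dq'] := step _ _ fx (proj_mem oe xe) iq dq.
have [|us [us0 use qus]] := IHr _ re' _ iq' dq'.
  apply: fixed => [/=|y yfix xy pxy /=]; last first.
    by rewrite yfix !refl_orth // polarDl pxy xy addr0.
  have -> : refl (psi x + x) (psi x) = - x.
    rewrite /refl (_ : B _ _ = f (psi x + x)) ?divff ?scale1r //.
      by rewrite opprD addrA subrr add0r.
    by rewrite quadD polarDl polar_diag fpx (polarC x); ring.
  rewrite /refl -scaleN1r polarZr polar_diag.
  have -> : -1 * (2%:R * f x) / f x = -1 + -1 by field.
  by rewrite scalerDl opprD addrA subrr add0r scaleN1r opprK.
exists [:: psi x + x, x & us]; split=> /= [|u|v]; first by rewrite fu fx.
  by rewrite !inE => /predU1P[->//|/predU1P[->|/use//]]; apply: proj_mem.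
by rewrite -qus /= !reflK.
Qed.

(** * Determinants of products of reflections *)

Lemma orth_uniq e : orth e -> uniq e.
Proof.
elim: e => //= x e IHe /orth_cons[fx xe /IHe->]; rewrite andbT.
by apply: contra fx => /xe/eqP; rewrite polar_diag_eq0.
Qed.

Lemma sum_nth e (g : V -> V) : \sum_(x <- e) g x = \sum_(i < size e) g e`_i.
Proof. by rewrite (big_nth 0) big_mkord. Qed.

Lemma orth_free e (c : 'I_(size e) -> F) :
  orth e -> \sum_i c i *: e`_i = 0 -> forall i, c i = 0.
Proof.
move=> oe ce0 i; have fi : f e`_i != 0.
  by case/andP: oe => _ /allP; apply; apply: mem_nth.
have : B e`_i (\sum_i c i *: e`_i) = 0 by rewrite ce0 polar0r.
rewrite polar_sum (bigD1 i) //= big1 => [/eqP|j ji].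
  by rewrite addr0 polarZr mulf_eq0 polar_diag_eq0 (negPf fi) orbF => /eqP.
by rewrite polarZr (@orth_polar0 e) ?mulr0 ?mem_nth // nth_uniq ?orth_uniq // eq_sym.
Qed.

Lemma proj_coef e v : proj e v = v ->
  exists c : 'I_(size e) -> F, v = \sum_i c i *: e`_i.
Proof.
by move=> <-; exists (fun i => B e`_i v / B e`_i e`_i); rewrite /proj sum_nth.
Qed.

Lemma refl_lin u a v w : refl u (a *: v + w) = a *: refl u v + refl u w.
Proof.
rewrite /refl polarDr polarZr mulrDl scalerDl opprD scalerBr scalerA mulrA.
by rewrite addrACA.
Qed.

Lemma refl_sum u (I : Type) (r : seq I) (c : I -> F) (g : I -> V) :
  refl u (\sum_(i <- r) c i *: g i) = \sum_(i <- r) c i *: refl u (g i).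
Proof.
elim: r => [|i r IHr]; rewrite ?big_nil ?big_cons ?refl_lin ?IHr //.
by rewrite refl_orth // polar0r.
Qed.

(** The matrix is the identity plus the rank one matrix [p *m q], so by [det1_mulmxC] its
    determinant is [1 - B u u / f u], that is, [1 - 2]. *)
Lemma refl_mx e u : orth e -> f u != 0 -> proj e u = u ->
  exists2 R : 'M[F]_(size e),
    is_mx_of (refl u) (fun i : 'I_(size e) => e`_i) R & \det R = -1.
Proof.
move=> oe fu /proj_coef[c uE].
pose p : 'cV[F]_(size e) := \col_i (- (B u e`_i / f u)).
pose q : 'rV[F]_(size e) := \row_i c i.
exists (1%:M + p *m q) => [i|].
  rewrite [in LHS]/refl; under eq_bigr do rewrite mxE scalerDl.
  rewrite big_split /= (bigD1 i) //= mxE eqxx scale1r big1 ?addr0; last first.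
    by move=> j ji; rewrite mxE eq_sym (negPf ji) scale0r.
  congr (_ + _); rewrite {3}uE scaler_sumr -sumrN; apply: eq_bigr => j _.
  by rewrite !mxE big_ord1 !mxE scalerA mulNr scaleNr.
rewrite det1_mulmxC [X in \det X]mx11_scalar det_scalar1 !mxE.
under eq_bigr do rewrite !mxE mulrN mulrA -polarZr.
rewrite sumrN -mulr_suml -polar_sum -uE polar_diag mulfK // eqxx.
by rewrite mulr1n; ring.
Qed.

Lemma refls_mx e us : orth e -> all (fun u => f u != 0) us ->
    (forall u, u \in us -> proj e u = u) ->
  exists2 N : 'M[F]_(size e),
    is_mx_of (refls us) (fun i : 'I_(size e) => e`_i) N &
    \det N = (-1) ^+ size us.
Proof.
move=> oe; elim: us => [|u us IHus] /= => [_ _|/andP[fu fus] use].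
  exists 1%:M => [i|]; last by rewrite det1.
  rewrite (bigD1 i) //= mxE eqxx scale1r big1 ?addr0 // => j ji.
  by rewrite mxE eq_sym (negPf ji) scale0r.
have [|N NP dN] := IHus fus.
  by move=> v vus; apply: use; rewrite inE vus orbT.
have [R RP dR] := refl_mx oe fu (use u (mem_head _ _)).
(* Rows hold the images of the basis, so the map applied first is the left factor. *)
exists (N *m R) => [i|]; last by rewrite det_mulmx dN dR exprSr.
rewrite /= NP refl_sum -mulmx_family.
by apply: eq_bigr => j _; rewrite RP.
Qed.

Lemma refls_disp e us v : (forall u, u \in us -> proj e u = u) ->
  proj e (refls us v - v) = refls us v - v.
Proof.
elim: us => [|u us IHus] use /=.
  by rewrite subrr proj_orth // => x _; rewrite polar0r.
rewrite -/(refls us v) /refl addrAC projB projZ (use u) ?mem_head // IHus // => w wus.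
by apply: use; rewrite inE wus orbT.
Qed.

(** * Nondegenerate hulls and maps induced on quotients by eigenspaces *)

Hypothesis ndf : quad_nondegenerate f.

(* Gram-Schmidt, except that a nonzero isotropic remainder [w'] is completed to
   a hyperbolic pair [w', s] and replaced by [w' + s] and [w' - s]. *)
Lemma orth_hull l : exists2 e, orth e & forall x, x \in l -> proj e x = x.
Proof.
elim: l => [|w l [e oe le]]; first by exists [::].
suff [e' [oe' we' ee']] : exists e', [/\ orth e', proj e' w = w &
    forall x, x \in e -> proj e' x = x].
  exists e' => // x; rewrite inE => /predU1P[->//|/le xe].
  exact: proj_sub_span ee' xe.
pose w' := w - proj e w.
have ew' y : y \in e -> B y w' = 0 by move=> ye; apply: polar_sub_proj.
have sub e' : orth e' -> {subset e <= e'} -> proj e' w' = w' -> proj e' w = w.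
  move=> oe' ee' w'P; rewrite -[w](subrK (proj e w)) projD w'P; congr (_ + _).
  by apply: proj_sub_span (proj_idem _ oe) => // x /ee'; apply: proj_mem.
have w'P : w' = 0 -> proj e w = w by move=> /subr0_eq.
have [w'0|w'N0] := eqVneq w' 0.
  by exists e; split=> [//||x]; [exact: w'P | exact: proj_mem].
clearbody w'.
have [fw'|fw'] := eqVneq (f w') 0; last first.
  have oe' : orth (w' :: e) by apply: consorth => // y /ew'; rewrite polarC.
  exists (w' :: e); split=> // [|x xe].
    apply: sub => // [x xe|]; first by rewrite inE xe orbT.
    by apply: proj_mem => //; apply: mem_head.
  by apply: proj_mem => //; rewrite inE xe orbT.
have [t wt] : exists t, B w' t != 0.
  apply: contrapT => nt; case/eqP: w'N0; apply: ndf => t.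
  by apply/eqP/negPn/negP => wt; apply: nt; exists t.
pose t1 := (B w' t)^-1 *: (t - proj e t).
have et1 y : y \in e -> B y t1 = 0.
  by move=> ye; rewrite polarZr polar_sub_proj ?mulr0.
have wt1 : B w' t1 = 1.
  rewrite polarZr polarBr polar_proj0 ?subr0 ?mulVf // => x xe.
  by rewrite polarC ew'.
(* Subtracting [f t1 *: w'] makes [s] isotropic while keeping [B w' s = 1]; then [f] is 1 at
   [w' + s] and -1 at [w' - s]. *)
pose s := t1 - f t1 *: w'.
have es y : y \in e -> B y s = 0.
  by move=> ye; rewrite polarBr polarZr et1 // ew' // mulr0 subr0.
have ww : B w' w' = 0 by apply/eqP; rewrite polar_diag_eq0 fw'.
have ws : B w' s = 1 by rewrite polarBr polarZr ww mulr0 subr0.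
have fs : f s = 0.
  rewrite quadB (quadratic_formZ quadf) fw' polarZr (polarC t1) wt1; ring.
clearbody s; have oe' : orth [:: w' + s, w' - s & e].
  apply: consorth; first by rewrite quadD fw' fs ws !add0r oner_eq0.
    move=> y; rewrite inE polarC => /predU1P[->|ye]; last first.
      by rewrite polarDr ew' // es // addr0.
    rewrite polarBl !polarDr ww ws (polarC s) ws polar_diag fs; ring.
  apply: consorth => //; first by rewrite quadB fw' fs ws addr0 sub0r oppr_eq0 oner_eq0.
  by move=> y ye; rewrite polarC polarBr ew' // es // subr0.
exists [:: w' + s, w' - s & e]; split=> // [|x xe]; last first.
  by apply: proj_mem => //; rewrite !inE xe !orbT.
apply: sub => // [x xe|]; first by rewrite !inE xe !orbT.
have w'E : w' = 2%:R^-1 *: ((w' + s) + (w' - s)).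
  by rewrite addrACA subrr addr0 -mulr2n -(scaler_nat 2) scalerA mulVf ?scale1r //.
rewrite {3}w'E projZ projD !proj_mem // ?mem_head // -?w'E //.
by rewrite !inE eqxx orbT.
Qed.

(** Let [e] span the vectors of [us]. Displacements of [a *: phi] lie in this span: [P] records
    those of lifts of a quotient basis, and [Q] expresses [e] in that basis modulo the eigenspace.
    Then [a *: phi] has matrix [1 + P Q] on the quotient and [1 + Q P] on the span of [e], and
    [det1_mulmxC] equates the determinants. *)
Lemma det_quot_eigen (phi : {linear V -> V}) a us k :
    a ^+ 2 = 1 -> all (fun u => f u != 0) us ->
    (forall v, a *: phi v = refls us v) ->
    has_dim (quot_space (eigen phi a)) k ->
  a ^+ k * lin_det (quot_eigen phi a) = (-1) ^+ size us.
Proof.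
move=> a2 fus phiE [b0 b0P].
have [e oe use] := orth_hull us.
pose b i : V := repr (b0 i).
have bE i : quot_proj (eigen phi a) (b i) = b0 i by rewrite /quot_proj reprK.
have aa : a * a = 1 by rewrite -expr2.
have /choice[p pE] := fun i => proj_coef (refls_disp (b i) use).
have [Q QE] := basis_change (fun j : 'I_(size e) => quot_proj (eigen phi a) e`_j) b0P.
pose P := \matrix_(i, j) p i j.
have phib i : phi (b i) = a *: (b i + \sum_j P i j *: e`_j).
  under eq_bigr do rewrite mxE.
  by rewrite -pE addrC subrK -phiE scalerA aa scale1r.
have mxM : is_mx_of (quot_eigen phi a) b0 (a *: (1%:M + P *m Q)).
  move=> i; rewrite -{1}bE quot_map_proj phib linearZ linearD linear_sum /= bE.
  under eq_bigr do rewrite linearZ /= QE.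
  rewrite mulmx_family; under [RHS]eq_bigr do rewrite mxE -scalerA mxE scalerDl.
  rewrite -scaler_sumr big_split /=; congr (_ *: (_ + _)).
  rewrite (bigD1 i) //= mxE eqxx scale1r big1 ?addr0 // => j ji.
  by rewrite mxE eq_sym (negPf ji) scale0r.
rewrite (lin_detE b0P mxM) detZ mulrA -exprMn aa expr1n mul1r det1_mulmxC.
have [N NP <-] := refls_mx oe fus use; congr (\det _).
have killE v : v \in eigen phi a -> refls us v = v.
  by move/eigenP; rewrite -phiE => ->; rewrite scalerA aa scale1r.
apply/matrixP => i l; apply/eqP; rewrite -subr_eq0; apply/eqP.
pose D := 1%:M + Q *m P - N.
suff : \sum_j D i j *: e`_j = 0 by move/(orth_free oe)/(_ l); rewrite !mxE.
pose s := \sum_j Q i j *: b j.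
have qpE : \sum_j (Q *m P) i j *: e`_j = refls us s - s.
  rewrite -(mulmx_family (fun j => e`_j) Q P) /s -phiE linear_sum scaler_sumr -sumrB.
  apply: eq_bigr => j _; under eq_bigr do rewrite mxE.
  by rewrite -pE -phiE linearZ scalerBr !scalerA mulrC.
(* A member of [e] and its lift [s] differ by a vector that [a *: phi] fixes, so they have the same
   displacement. *)
have /killE : e`_i - s \in eigen phi a.
  apply/quot_projP; rewrite QE linear_sum; apply: eq_bigr => j _.
  by rewrite linearZ /= bE.
rewrite -phiE linearB scalerBr !phiE => sE.
under eq_bigr do rewrite mxE [X in X + _]mxE [X in _ + X]mxE scalerBl scalerDl.
rewrite sumrB big_split /= qpE -NP (bigD1 i) //= mxE eqxx scale1r big1 ?addr0; last first.
  by move=> j ji; rewrite mxE eq_sym (negPf ji) scale0r.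
by rewrite addrCA -sE [X in X - _]addrC subrK subrr.
Qed.

Lemma orthogonal_polar_preserving (psi : {linear V -> V}) :
  orthogonal_map f psi -> polar_preserving psi.
Proof. by move=> opsi v w; rewrite /polar -linearD !opsi. Qed.

Lemma proj_sum e (I : Type) (r : seq I) (g : I -> V) :
  proj e (\sum_(i <- r) g i) = \sum_(i <- r) proj e (g i).
Proof.
elim: r => [|i r IHr]; rewrite ?big_nil ?big_cons ?projD ?IHr //.
by rewrite proj_orth // => x _; rewrite polar0r.
Qed.

(** Every [v] is [proj e v] plus a vector orthogonal to [e], so all displacements lie in a
    nondegenerate hull of [e] and its image, and [polar_preserving_reflections] applies there. *)
Lemma displacement_reflections (psi : {linear V -> V}) e :
    orth e -> polar_preserving psi ->
    (forall v, (forall x, x \in e -> B x v = 0) -> proj e (psi v - v) = psi v - v) ->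
  exists2 us, all (fun u => f u != 0) us & forall v, psi v = refls us v.
Proof.
move=> oe ipsi dpsi; have [e2 oe2 e2P] := orth_hull (e ++ map psi e).
have e2e x : x \in e -> proj e2 x = x by move=> xe; apply: e2P; rewrite mem_cat xe.
have e2psi x : x \in e -> proj e2 (psi x) = psi x.
  by move=> xe; apply: e2P; rewrite mem_cat map_f ?orbT.
have [|us [us0 _ usP]] := polar_preserving_reflections oe2 ipsi; last by exists us.
move=> v; rewrite -(subrK (proj e v) v); set w := v - _.
have wdisp : proj e2 (psi w - w) = psi w - w.
  by apply: (proj_sub_span e2e); apply: dpsi => x; apply: polar_sub_proj.
rewrite linearD opprD addrACA projD wdisp projB; congr (_ + (_ - _)).
  rewrite linear_sum proj_sum; apply: eq_big_seq => x xe.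
  by rewrite linearZ projZ e2psi.
exact: proj_sub_span e2e (proj_idem v oe).
Qed.

(** The displacement [a *: phi v - v] depends only on the class of [v] modulo the eigenspace, so
    finitely many displacements span all of them. *)
Lemma eigen_reflections (phi : {linear V -> V}) a :
    orthogonal_map f phi -> a ^+ 2 = 1 ->
    finite_dim (quot_space (eigen phi a)) ->
  exists2 us, all (fun u => f u != 0) us & forall v, a *: phi v = refls us v.
Proof.
move=> ophi a2 [k [b [_ bspan]]].
have ipsi : polar_preserving (a \*: phi).
  apply: orthogonal_polar_preserving => v /=.
  by rewrite (quadratic_formZ quadf) a2 mul1r ophi.
have [e oe eP] :=
  orth_hull [seq a *: phi (repr (b i)) - repr (b i) | i <- enum 'I_k].
apply: (displacement_reflections oe ipsi) => v _ /=.
have [c vE] := bspan (quot_proj (eigen phi a) v).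
pose w := \sum_i c i *: repr (b i).
have wE : quot_proj (eigen phi a) w = quot_proj (eigen phi a) v.
  rewrite vE linear_sum; apply: eq_bigr => i _.
  by rewrite linearZ /= /quot_proj reprK.
have /quot_projP/eigenP vw := esym wE.
have -> : a *: phi v - v = a *: phi w - w.
  rewrite -(subrK w v) linearD vw scalerDr scalerA -expr2 a2 scale1r.
  by rewrite opprD addrACA subrr add0r.
rewrite linear_sum scaler_sumr -sumrB proj_sum; apply: eq_bigr => i _.
rewrite linearZ /= scalerA mulrC -scalerA -scalerBr projZ eP //.
by apply/map_f/mem_enum.
Qed.

(** Vectors orthogonal to a hull [e] of [us] are fixed by all the reflections, so the classes of [e]
    span the quotient. *)
Lemma reflections_eigen (phi : {linear V -> V}) a us :
    a ^+ 2 = 1 -> (forall v, a *: phi v = refls us v) ->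
  finite_dim (quot_space (eigen phi a)).
Proof.
move=> a2 phiE; have [e oe use] := orth_hull us.
apply: (@spanned_finite_dim _ _ (size e) (fun i => quot_proj (eigen phi a) e`_i)).
elim/quot_ind=> v; have [c cE] := proj_coef (proj_idem v oe).
exists c; under eq_bigr do rewrite -linearZ.
rewrite -linear_sum -cE; apply/quot_projP/eigenP.
have uv0 u : u \in us -> B u (v - proj e v) = 0.
  by move=> uus; rewrite -(use u uus) polar_proj.
have {2}<- : refls us (v - proj e v) = v - proj e v.
  elim: us uv0 {phiE use} => //= u us IHus uv0.
  rewrite IHus => [|w wus]; last by apply: uv0; rewrite inE wus orbT.
  by rewrite refl_orth // uv0 ?mem_head.
by rewrite -phiE scalerA -expr2 a2 scale1r.
Qed.

End QuadraticSpace.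

(** * Parity and finitely generated subalgebras of the Clifford algebra *)

Section CliffordAlgebra.
Variables (F : fieldType) (V : lmodType F) (f : V -> F).
Hypotheses (charF : 2%N \notin [pchar F]) (quadf : quadratic_form f).
Implicit Types (a b : F) (u v w : V) (e l us : seq V) (x y z : Cl f).

Local Notation B := (polar f).
Local Notation vec := (cl_vec f).
Local Notation scal := (cl_scal f).

Lemma cl_vec_anticomm u v : vec u * vec v + vec v * vec u = scal (B u v).
Proof.
rewrite /polar !rmorphB /= -!cl_vec_sqr linearD mulrDl !mulrDr.
by rewrite addrAC addrA addrK -!addrA addrC !addrA subrK.
Qed.

Fact opp_orthogonal : orthogonal_map f (\- idfun : {linear V -> V}).
Proof. by move=> v /=; rewrite -scaleN1r (quadratic_formZ quadf) sqrrN expr1n mul1r. Qed.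

Definition cl_grade : {rmorphism Cl f -> Cl f} := bogolyubov opp_orthogonal.

Lemma cl_grade_scal a : cl_grade (scal a) = scal a.
Proof. exact: cl_lift_scal. Qed.

Lemma cl_grade_vec v : cl_grade (vec v) = - vec v.
Proof. by rewrite /cl_grade bogolyubov_vec /= linearN. Qed.

Lemma cl_gradeK : involutive cl_grade.
Proof.
elim/cl_ind => [a|v|x y xK yK|x y xK yK].
- by rewrite !cl_grade_scal.
- by rewrite cl_grade_vec rmorphN /= cl_grade_vec opprK.
- by rewrite !rmorphD /= xK yK.
- by rewrite !rmorphM /= xK yK.
Qed.

Inductive cl_gen l : Cl f -> Prop :=
| cl_gen_scal a : cl_gen l (scal a)
| cl_gen_vec v : v \in l -> cl_gen l (vec v)
| cl_genD x y : cl_gen l x -> cl_gen l y -> cl_gen l (x + y)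
| cl_genM x y : cl_gen l x -> cl_gen l y -> cl_gen l (x * y).

Lemma cl_gen_sub l l' x :
  (forall v, v \in l -> cl_gen l' (vec v)) -> cl_gen l x -> cl_gen l' x.
Proof.
move=> ll'; elim=> [a|v /ll'//|y z _ ? _ ?|y z _ ? _ ?].
- exact: cl_gen_scal.
- exact: cl_genD.
- exact: cl_genM.
Qed.

Lemma cl_gen_exists x : exists l, cl_gen l x.
Proof.
elim/cl_ind: x => [a|v|x y [l1 x1] [l2 y2]|x y [l1 x1] [l2 y2]].
- by exists [::]; constructor.
- by exists [:: v]; apply/cl_gen_vec/mem_head.
- exists (l1 ++ l2); apply: cl_genD; [apply: cl_gen_sub x1|apply: cl_gen_sub y2];
    by move=> v vl; apply: cl_gen_vec; rewrite mem_cat vl ?orbT.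
- exists (l1 ++ l2); apply: cl_genM; [apply: cl_gen_sub x1|apply: cl_gen_sub y2];
    by move=> v vl; apply: cl_gen_vec; rewrite mem_cat vl ?orbT.
Qed.

Lemma cl_gen_proj e v : proj f e v = v -> cl_gen e (vec v).
Proof.
move=> <-; suff gen r : {subset r <= e} -> cl_gen e (vec (proj f r v)) by apply: gen.
elim: r => [|w r IHr] re.
  by rewrite /proj big_nil linear0 -(rmorph0 scal); apply: cl_gen_scal.
rewrite /proj big_cons linearD linearZ /= cl_scaleE; apply: cl_genD.
  by apply: cl_genM; [exact: cl_gen_scal | apply/cl_gen_vec/re/mem_head].
by apply: IHr => u ur; apply: re; rewrite inE ur orbT.
Qed.

Lemma cl_gen_grade l x : cl_gen l x -> cl_gen l (cl_grade x).
Proof.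
elim=> [a|v vl|y z _ gy _ gz|y z _ gy _ gz].
- by rewrite cl_grade_scal; apply: cl_gen_scal.
- rewrite cl_grade_vec -mulN1r -(rmorphN1 scal).
  by apply: cl_genM; [exact: cl_gen_scal | exact: cl_gen_vec].
- by rewrite rmorphD; apply: cl_genD.
- by rewrite rmorphM; apply: cl_genM.
Qed.

(** [vec w] anticommutes with each generator; moving it across a product of n of them costs the sign
    that the grading gives. *)
Lemma cl_gen_comm l w x : (forall v, v \in l -> B v w = 0) -> cl_gen l x ->
  vec w * x = cl_grade x * vec w.
Proof.
move=> lw; elim=> [a|v vl|y z _ gy _ gz|y z _ gy _ gz].
- by rewrite cl_grade_scal cl_scal_central.
- rewrite cl_grade_vec mulNr; apply/eqP; rewrite -addr_eq0 addrC.
  by rewrite cl_vec_anticomm lw ?rmorph0.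
- by rewrite rmorphD mulrDr gy gz mulrDl.
- by rewrite rmorphM mulrA gy -!mulrA gz.
Qed.

(** Products keep this form because [vec u] can be moved to the left past elements generated by [e],
    at the cost of a grading, and squares to [f u]. *)
Lemma cl_gen_cons u e z : (forall v, v \in e -> B v u = 0) ->
  cl_gen (u :: e) z ->
  exists x y, [/\ cl_gen e x, cl_gen e y & z = x + vec u * y].
Proof.
move=> eu; have g0 : cl_gen e 0 by rewrite -(rmorph0 scal); apply: cl_gen_scal.
have g1 : cl_gen e 1 by rewrite -(rmorph1 scal); apply: cl_gen_scal.
elim=> [a|v vl|z1 z2 _ [x1 [y1 [gx1 gy1 ->]]] _ [x2 [y2 [gx2 gy2 ->]]]
  |z1 z2 _ [x1 [y1 [gx1 gy1 ->]]] _ [x2 [y2 [gx2 gy2 ->]]]].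
- by exists (scal a), 0; split; rewrite ?mulr0 ?addr0 //; apply: cl_gen_scal.
- move: vl; rewrite inE => /predU1P[->|ve].
    by exists 0, 1; split; rewrite ?mulr1 ?add0r.
  by exists (vec v), 0; split; rewrite ?mulr0 ?addr0 //; apply: cl_gen_vec.
- exists (x1 + x2), (y1 + y2); split; try exact: cl_genD.
  by rewrite mulrDr addrACA.
exists (x1 * x2 + scal (f u) * (cl_grade y1 * y2)), (cl_grade x1 * y2 + y1 * x2); split.
- apply: cl_genD; apply: cl_genM => //; first exact: cl_gen_scal.
  by apply: cl_genM => //; apply: cl_gen_grade.
- by apply: cl_genD; apply: cl_genM => //; apply: cl_gen_grade.
have x1u : vec u * cl_grade x1 = x1 * vec u.
  by rewrite (cl_gen_comm eu) ?cl_gradeK //; apply: cl_gen_grade.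
have uyu : vec u * y1 * vec u = scal (f u) * cl_grade y1.
  rewrite -cl_vec_sqr -!mulrA; congr (_ * _).
  by rewrite (cl_gen_comm eu) ?cl_gradeK //; apply: cl_gen_grade.
rewrite mulrDl !mulrDr !mulrA x1u uyu -!addrA; congr (_ + _).
by rewrite addrA addrC addrA; congr (_ + _); rewrite addrC.
Qed.

(** Write [z = x + vec u * y]. The condition at [u] compares [f u] times [y] with its opposite, so
    [y = 0] and [u] is eliminated from [z]. *)
Lemma cl_supercentral e z : orth f e -> cl_gen e z ->
  (forall v, v \in e -> vec v * z = cl_grade z * vec v) -> exists a, z = scal a.
Proof.
elim: e z => [|u e IHe] z oe gz zc.
  elim: gz => [a|//|x y _ [a ->] _ [b ->]|x y _ [a ->] _ [b ->]].
  - by exists a.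
  - by exists (a + b); rewrite rmorphD.
  - by exists (a * b); rewrite rmorphM.
have [fu ue oe'] := orth_cons oe.
have eu v : v \in e -> B v u = 0 by move=> /ue; rewrite polarC.
have [x [y [gx gy zE]]] := cl_gen_cons eu gz.
have ux := cl_gen_comm eu gx.
have uy := cl_gen_comm eu gy.
have y0 : y = 0.
  have := zc u (mem_head _ _); rewrite zE rmorphD rmorphM /= cl_grade_vec.
  rewrite mulrDl mulrDr ux => /addrI; rewrite mulNr mulNr -mulrA -uy.
  rewrite mulrA cl_vec_sqr => /eqP; rewrite -addr_eq0 -mulr2n -cl_scaleE -scaler_nat.
  by rewrite scalerA scaler_eq0 mulf_eq0 (negPf fu) (negPf (two_neq0 charF)) => /eqP.
have zx : z = x by rewrite zE y0 mulr0 addr0.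
rewrite zx; apply: IHe => // v ve; rewrite -zx; apply: zc.
by rewrite inE ve orbT.
Qed.

End CliffordAlgebra.

(* A derivation of [cl_eq f] uses the relation [v ^ 2 = f v] for finitely many
   [v] only, so a representation of a finite-dimensional subspace suffices to
   refute [1 = 0]. *)
Lemma cl_eq_local (F : fieldType) (V : lmodType F) (f : V -> F) s t :
  cl_eq f s t -> exists l : seq V,
    forall (A : pzRingType) (h : {rmorphism F -> A}) (g : {additive V -> A}),
      (forall a x, h a * x = x * h a) -> (forall a v, g (a *: v) = h a * g v) ->
      (forall v, v \in l -> g v * g v = h (f v)) ->
    cl_eval h g s = cl_eval h g t.
Proof.
elim=> /=.
- by exists [::].
- by move=> x y _ [l lP]; exists l => *; rewrite lP.
- move=> x y z _ [l lP] _ [l' lP']; exists (l ++ l') => A h g hC gZ gl.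
  rewrite lP ?lP' // => v vl; by apply: gl; rewrite mem_cat vl ?orbT.
- move=> x x' y y' _ [l lP] _ [l' lP']; exists (l ++ l') => A h g hC gZ gl.
  rewrite lP ?lP' // => v vl; by apply: gl; rewrite mem_cat vl ?orbT.
- move=> x x' y y' _ [l lP] _ [l' lP']; exists (l ++ l') => A h g hC gZ gl.
  rewrite lP ?lP' // => v vl; by apply: gl; rewrite mem_cat vl ?orbT.
- by exists [::] => *; rewrite addrA.
- by exists [::] => *; rewrite addrC.
- by exists [::] => *; rewrite rmorph0 add0r.
- by exists [::] => *; rewrite rmorphN1 mulN1r addNr rmorph0.
- by exists [::] => *; rewrite mulrA.
- by exists [::] => *; rewrite rmorph1 mul1r.
- by exists [::] => *; rewrite mulrDl.
- by exists [::] => *; rewrite mulrDr.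
- by exists [::] => *; rewrite rmorphD.
- by exists [::] => *; rewrite rmorphM.
- by exists [::] => *; auto.
- by exists [::] => *; rewrite raddfD.
- by exists [::] => *; auto.
- by move=> v; exists [:: v] => A h g _ _; apply; rewrite mem_head.
Qed.

(** * Two-by-two matrices over a ring that need not be commutative *)

Section TwoByTwo.
Variable A : nzRingType.
Implicit Types (a b c d : A).

Definition mx22 a b c d : 'M[A]_2 :=
  \matrix_(i, j) (if i == 0 then (if j == 0 then a else b)
                  else (if j == 0 then c else d)).

Lemma mx22P (x : 'M[A]_2) : exists a b c d, x = mx22 a b c d.
Proof.
exists (x 0 0), (x 0 1), (x 1 0), (x 1 1); apply/matrixP => i j; rewrite mxE.
by case: i => [[|[|[]]] //= lti]; case: j => [[|[|[]]] //= ltj];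
  congr (x _ _); apply: val_inj.
Qed.

Lemma mx22D a b c d a' b' c' d' :
  mx22 a b c d + mx22 a' b' c' d' = mx22 (a + a') (b + b') (c + c') (d + d').
Proof. by apply/matrixP => i j; rewrite !mxE; case: (i == 0); case: (j == 0). Qed.

Lemma mx22M a b c d a' b' c' d' :
  mx22 a b c d * mx22 a' b' c' d' =
  mx22 (a * a' + b * c') (a * b' + b * d') (c * a' + d * c') (c * b' + d * d').
Proof.
apply/matrixP => i j; rewrite !mxE !big_ord_recl big_ord0 addr0 !mxE /=.
by case: (i == 0); case: (j == 0).
Qed.

Lemma scalar_mx22 a : a%:M = mx22 a 0 0 a.
Proof.
apply/matrixP => i j; rewrite !mxE.
by case: i => [[|[|[]]] //= lti]; case: j => [[|[|[]]] //= ltj].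
Qed.

End TwoByTwo.

(** * Nontriviality of the Clifford algebra *)

Section Nontriviality.
Variables (F : fieldType) (V : lmodType F) (f : V -> F).
Hypotheses (charF : 2%N \notin [pchar F]) (quadf : quadratic_form f).
Local Notation B := (polar f).

(** Each new vector [u] doubles the matrix size. With [c v] the coordinate of [v] along [u], the
    off-diagonal entries cancel in the square, as [h] is central, and the diagonal ones gain
    [f u * c v ^ 2]. *)
Lemma clifford_representation e : orth f e ->
  exists (A : nzRingType) (h : {rmorphism F -> A}) (g : V -> A),
    [/\ forall a x, h a * x = x * h a,
        forall a v w, g (a *: v + w) = h a * g v + g w &
        forall v, g v * g v = h (f (proj f e v))].
Proof.
elim: e => [|u e IHe] oe.
  exists F, idfun, (fun=> 0); split=> [a x|a v w|v] /=.
  - exact: mulrC.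
  - by rewrite mulr0 addr0.
  - rewrite mulr0 /proj big_nil.
    by rewrite -(scale0r 0) (quadratic_formZ quadf) expr0n mul0r.
have [fu ue oe'] := orth_cons oe.
have [A [h [g [hC gL g2]]]] := IHe oe'.
pose c v : F := B u v / B u u.
have cL a v w : c (a *: v + w) = a * c v + c w.
  by rewrite /c (polarDr quadf) (polarZr quadf) mulrDl mulrA.
pose H : {rmorphism F -> 'M[A]_2} := scalar_mx \o h.
exists ('M[A]_2 : nzRingType), H,
  (fun v => mx22 (g v) (h (f u * c v)) (h (c v)) (- g v)).
have HE a : H a = mx22 (h a) 0 0 (h a) by apply: scalar_mx22.
split=> [a x|a v w|v].
- have [x1 [x2 [x3 [x4 ->]]]] := mx22P x.
  by rewrite HE !mx22M !(mul0r, mulr0, addr0, add0r) !hC.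
- rewrite HE mx22M mx22D !(mul0r, mulr0, addr0, add0r) gL cL mulrDr mulrCA.
  by rewrite !rmorphD !rmorphM opprD mulrN.
have qE : f (proj f (u :: e) v) = f (proj f e v) + f u * c v * c v.
  rewrite proj_cons -/(c v) quadD (quadratic_formZ quadf) polarZl //.
  by rewrite polar_proj0 //; ring.
rewrite mx22M HE mulrN mulNr mulrNN -!rmorphM g2 -!rmorphD !hC !subrr qE.
by congr (mx22 _ _ _ (h _)); ring.
Qed.

(** A derivation of [0 = 1] involves a finite list [l]. Projection onto a hull of [l] fixes [l], so
    the matrix representation of that hull respects the derivation, yet its target is a nonzero
    ring. *)
Lemma Cl_oner_neq0 : quad_nondegenerate f -> (1 : Cl f) != 0.
Proof.
move=> ndf; apply/eqP => /esym eq10.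
have /clpiP/cl_eq_local[l lP] : clpi f (ClScal 0) = clpi f (ClScal 1) by exact: eq10.
have [e oe eP] := orth_hull charF quadf ndf l.
have [A [h [g [hC gL g2]]]] := clifford_representation oe.
have g0 : g 0 = 0.
  by have := gL (-1) 0 0; rewrite scaler0 addr0 rmorphN1 mulN1r addNr.
have gB : zmod_morphism g.
  by move=> v w; rewrite addrC -scaleN1r gL rmorphN1 mulN1r addrC.
pose G : {additive V -> A} := HB.pack g (GRing.isZmodMorphism.Build V A g gB).
have GZ a v : G (a *: v) = h a * G v by rewrite -[a *: v]addr0 /= gL g0 addr0.
have G2 v : v \in l -> G v * G v = h (f v) by move=> /eP vE; rewrite /= g2 vE.
have := lP A h G hC GZ G2; rewrite /= rmorph0 rmorph1 => /eqP.
by rewrite eq_sym oner_eq0.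
Qed.

End Nontriviality.

(** * Conjugation in the Clifford algebra and products of reflections *)

Section InnerBogolyubov.
Variables (F : fieldType) (V : lmodType F) (f : V -> F).
Hypotheses (charF : 2%N \notin [pchar F]) (quadf : quadratic_form f).
Implicit Types (a b : F) (u v w : V) (e l us : seq V) (x y z : Cl f).

Local Notation B := (polar f).
Local Notation vec := (cl_vec f).
Local Notation scal := (cl_scal f).
Local Notation grade := (cl_grade quadf).

Lemma vec_conj_refl u v : f u != 0 ->
  vec v * vec u = - (vec u * vec (refl f u v)).
Proof.
move=> fu; rewrite /refl linearB linearZ /= mulrBr -cl_scalerAr cl_vec_sqr.
rewrite cl_scaleE -rmorphM divfK //= -cl_vec_anticomm //.
by rewrite opprB addrC addrA addNr add0r.
Qed.

Lemma reflections_conj us : all (fun u => f u != 0) us ->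
  exists x y, [/\ x * y = 1, y * x = 1, grade x = (-1) ^+ size us *: x &
    forall v, vec v * x = (-1) ^+ size us *: (x * vec (refls f us v))].
Proof.
elim: us => [|u us IHus] /=.
  by exists 1, 1; split=> [||| v]; rewrite ?mulr1 ?rmorph1 ?scale1r ?mul1r.
case/andP=> fu /IHus[x [y [xy yx gx xP]]].
have uu : vec u * ((f u)^-1 *: vec u) = 1.
  rewrite -cl_scalerAr cl_vec_sqr cl_scaleE -rmorphM mulVf //; exact: rmorph1.
(* The new factor goes on the right because [refls] applies the head of the list last. *)
exists (x * vec u), (((f u)^-1 *: vec u) * y); split=> [||| v].
- by rewrite -mulrA (mulrA (vec u)) uu mul1r.
- by rewrite -mulrA (mulrA y) yx mul1r -cl_scalerAl cl_scalerAr uu.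
- rewrite rmorphM /= gx cl_grade_vec mulrN -cl_scalerAl exprS mulN1r scaleNr //.
- rewrite mulrA xP -cl_scalerAl -mulrA vec_conj_refl // mulrN scalerN -scaleNr.
  by rewrite exprS mulN1r mulrA.
Qed.

(** The sign in the hypothesis cancels the one from [reflections_conj]; agreement on scalars and
    vectors then extends to sums and products. *)
Lemma reflections_inner (phi : {linear V -> V}) (ophi : orthogonal_map f phi) us :
    all (fun u => f u != 0) us ->
    (forall v, (-1) ^+ size us *: phi v = refls f us v) ->
  inner (bogolyubov ophi).
Proof.
move=> fus phiE; have [x [y [xy yx _ xP]]] := reflections_conj fus.
exists x, y; split=> //; elim/cl_ind => [a|v|z t zE tE|z t zE tE].
- by rewrite [LHS]cl_lift_scal -mulrA cl_scal_central mulrA yx mul1r.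
- rewrite bogolyubov_vec -mulrA xP -phiE linearZ /= -!cl_scalerAr scalerA.
  by rewrite -exprMn mulrNN mulr1 expr1n scale1r mulrA yx mul1r.
- by rewrite rmorphD /= zE tE mulrDr mulrDl.
- by rewrite rmorphM /= zE tE -!mulrA (mulrA x) xy mul1r.
Qed.

Hypothesis ndf : quad_nondegenerate f.

Lemma cl_gen_orth z : exists2 e, orth f e & cl_gen e z.
Proof.
have [l gz] := cl_gen_exists z; have [e oe el] := orth_hull charF quadf ndf l.
by exists e => //; apply: cl_gen_sub gz => v /el; apply: cl_gen_proj.
Qed.

(** If [w] is orthogonal to [e], multiplying [u w + w u = B u w] on the left by [z] gives 0, because
    [z w u] equals [w] times [grade z * vec u], which vanishes as well. So [B u w = 0], and
    nondegeneracy leaves no component of [u] orthogonal to [e]. *)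
Lemma cl_gen_annihilator e z u : orth f e -> cl_gen e z -> z != 0 ->
  z * vec u = 0 -> proj f e u = u.
Proof.
move=> oe gz z0 zu.
have uw w : (forall v, v \in e -> B v w = 0) -> B u w = 0.
  move=> ew; have gzu : grade z * vec u = 0.
    have := congr1 grade zu; rewrite rmorphM rmorph0 /= cl_grade_vec mulrN.
    by move/eqP; rewrite oppr_eq0 => /eqP.
  have : z * scal (B u w) = 0.
    rewrite -cl_vec_anticomm // mulrDr mulrA zu mul0r add0r mulrA.
    have := cl_gen_comm quadf ew (cl_gen_grade quadf gz).
    by rewrite cl_gradeK => <-; rewrite -mulrA gzu mulr0.
  by move/eqP; rewrite -cl_scal_central -cl_scaleE scaler_eq0 (negPf z0) orbF => /eqP.
apply/esym/subr0_eq/ndf => v; rewrite -(subrK (proj f e v) v) polarDr //.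
rewrite (polarC f _ (proj f e v)) polar_proj // addr0 polarBl // polar_proj // subr0.
by apply: uw => w we; apply: polar_sub_proj.
Qed.

(** Being odd, [z] satisfies the hypothesis of [cl_supercentral], so it is a scalar, hence also
    even. *)
Lemma odd_anticentral_eq0 z :
  grade z = - z -> (forall v, vec v * z = - (z * vec v)) -> z = 0.
Proof.
move=> gz zc; have [e oe ez] := cl_gen_orth z.
have [c zE] : exists c, z = scal c.
  by apply: (cl_supercentral (quadf := quadf) charF oe ez) => v _; rewrite gz zc mulNr.
move: gz => /eqP; rewrite {1}zE cl_grade_scal -zE -addr_eq0 -mulr2n -scaler_nat.
by rewrite scaler_eq0 (negPf (two_neq0 charF)) => /eqP.
Qed.

Lemma inner_reflections (phi : {linear V -> V}) (ophi : orthogonal_map f phi) :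
    ~ finite_dim V -> inner (bogolyubov ophi) ->
  exists2 us, all (fun u => f u != 0) us &
    forall v, (-1) ^+ size us *: phi v = refls f us v.
Proof.
move=> dimV [x [y [xy yx inn]]].
have cl10 := Cl_oner_neq0 charF quadf ndf.
have xphi v : x * vec (phi v) = vec v * x.
  by rewrite -bogolyubov_vec inn !mulrA xy mul1r.
have [e oe gx] := cl_gen_orth x.
pose p b := x + b *: grade x.
have gp b : cl_gen e (p b).
  apply: cl_genD => //; rewrite cl_scaleE; apply: cl_genM; first exact: cl_gen_scal.
  exact: cl_gen_grade.
(* Both [x (phi w) = (grade x) w] and its image under the grading hold, so [p b] annihilates
   [b *: phi w - w]. *)
have disp b w : b ^+ 2 = 1 -> p b != 0 -> (forall v, v \in e -> B v w = 0) ->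
    proj f e (b *: phi w - w) = b *: phi w - w.
  move=> b2 pb ew; apply: (cl_gen_annihilator oe (gp b) pb).
  have xw : x * vec (phi w) = grade x * vec w by rewrite xphi; apply: cl_gen_comm gx.
  have gxw : grade x * vec (phi w) = x * vec w.
    have := congr1 grade xw; rewrite !rmorphM /= !cl_grade_vec cl_gradeK !mulrN.
    exact: oppr_inj.
  rewrite linearB linearZ /= mulrBr -cl_scalerAr !mulrDl xw -!cl_scalerAl gxw.
  rewrite scalerDr scalerA -expr2 b2 scale1r.
  by rewrite [X in X - _]addrC subrr.
have N1 : (-1) ^+ 2 = 1 :> F by rewrite sqrrN expr1n.
(* If neither vanished, then for [w] orthogonal to [e] both [phi w - w] and [- phi w - w] would lie
   in the span of [e]. This forces [w = 0], so [e] would span [V]. *)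
have p1N : p 1 = 0 \/ p (-1) = 0.
  have [->|p1] := eqVneq (p 1) 0; first by left.
  have [->|pN] := eqVneq (p (-1)) 0; first by right.
  case: dimV; apply: (@spanned_finite_dim _ _ (size e) (fun i => e`_i)) => v.
  apply: (@proj_coef _ _ f); set w := v - proj f e v.
  have ew u : u \in e -> B u w = 0 by apply: polar_sub_proj.
  have w0 : proj f e w = 0 by apply: proj_orth.
  have := disp 1 w (expr1n _ _) p1 ew; rewrite scale1r projB // w0 subr0 => d1.
  have := disp (-1) w N1 pN ew; rewrite projB // projZ // w0 subr0 d1 scalerBr.
  move/addrI/oppr_inj/eqP; rewrite scaleN1r eq_sym -addr_eq0 -mulr2n -scaler_nat.
  by rewrite scaler_eq0 (negPf (two_neq0 charF)) /= subr_eq0 eq_sym => /eqP.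
have x0 : x != 0 by apply: contra_neq cl10 => x0; rewrite -xy x0 mul0r.
(* The sign [b] is the parity of [x], and [p b] is twice [x]. *)
have [b [b2 pb gxb]] : exists b, [/\ b ^+ 2 = 1, p b != 0 & grade x = b *: x].
  have pick b : b ^+ 2 = 1 -> p (- b) = 0 -> p b != 0 /\ grade x = b *: x.
    move=> b2 /eqP; rewrite /p scaleNr subr_eq0 => /eqP xE.
    have gxE : grade x = b *: x by rewrite {2}xE scalerA -expr2 b2 scale1r.
    split=> //; rewrite gxE scalerA -expr2 b2 scale1r -mulr2n -scaler_nat.
    by rewrite scaler_eq0 negb_or (two_neq0 charF).
  case: p1N => p0; [exists (-1) | exists 1].
    by have [|pN gxN] := pick _ N1; first by rewrite opprK.
  by have [|p1 gx1] := pick _ (expr1n _ 2); rewrite ?expr1n.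
have ipsi : polar_preserving f (b \*: phi).
  apply: orthogonal_polar_preserving => v /=.
  by rewrite (quadratic_formZ quadf) b2 mul1r ophi.
have [us fus phiE] := displacement_reflections charF quadf ndf oe ipsi
  (fun v => @disp b v b2 pb).
exists us => // v; rewrite -phiE /=; congr (_ *: _).
(* Both signs square to 1, so only [(-1) ^+ size us = - b] has to be excluded. *)
have : ((-1) ^+ size us - b) * ((-1) ^+ size us + b) == 0.
  by rewrite -subr_sqr b2 -exprM mulnC exprM N1 expr1n subrr.
rewrite mulf_eq0 subr_eq0 addr_eq0 => /orP[/eqP//|/eqP sb].
have [t [s [ts st gt tP]]] := reflections_conj fus.
have tv w : vec w * t = - (t * vec (phi w)).
  by rewrite tP -phiE /= linearZ /= -cl_scalerAr scalerA sb mulNr -expr2 b2 scaleN1r.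
have vs w : vec (phi w) * s = - (s * vec w).
  have := congr1 (fun z => s * z * s) (tv w).
  rewrite mulrN mulNr !mulrA st mul1r -(mulrA (s * _)) ts mulr1 => ->.
  by rewrite opprK.
have gs : grade s = - b *: s.
  have := congr1 grade ts; rewrite rmorphM rmorph1 /= gt sb -cl_scalerAl => tgs.
  have := congr1 ( *%R s) tgs; rewrite mulr1 -cl_scalerAr mulrA st mul1r => sE.
  by rewrite -[in RHS]sE scalerA mulrNN -expr2 b2 scale1r.
(* The parities of [x] and [s] are [b] and [- b], so the product is odd. *)
have xs0 : x * s = 0.
  apply: odd_anticentral_eq0 => [|w].
    rewrite rmorphM /= gxb gs -cl_scalerAl -cl_scalerAr scalerA mulrN -expr2 b2.
    by rewrite scaleN1r.
  by rewrite mulrA -xphi -!mulrA vs mulrN.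
by case/eqP: x0; rewrite -[x]mulr1 -st mulrA xs0 mul0r.
Qed.

End InnerBogolyubov.

(** * From products of reflections to the two cases of the criterion *)

Lemma quot_eigen_dim_det (F : fieldType) (charF : 2%N \notin [pchar F])
    (V : lmodType F) (f : V -> F) (quadf : quadratic_form f)
    (ndf : quad_nondegenerate f) (phi : {linear V -> V}) a us :
    a ^+ 2 = 1 -> all (fun u => f u != 0) us ->
    (forall v, a *: phi v = refls f us v) ->
  exists k, has_dim (quot_space (eigen phi a)) k /\
    a ^+ k * lin_det (quot_eigen phi a) = (-1) ^+ size us.
Proof.
move=> a2 fus phiE; have [k kP] := reflections_eigen charF quadf ndf a2 phiE.
by exists k; split=> //; apply: (det_quot_eigen charF quadf ndf).
Qed.

Lemma lin_det0 (F : fieldType) (U : lmodType F) (psi : {linear U -> U}) :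
  has_dim U 0 -> lin_det psi = 1.
Proof.
move=> [b bP]; rewrite (@lin_detE _ _ psi _ b 0 bP) ?det_mx00 //.
by move=> [].
Qed.

(** Together with [has_dim_quot_eq], this bridges the quotient used in [finitary] and the one used
    in [quot_eigen]. *)
Lemma kernel_eigen1 (F : fieldType) (V : lmodType F) (phi : {linear V -> V}) :
  (kernel (phi \- idfun) : submodClosed V) =i eigen phi 1.
Proof. by move=> v; rewrite !unfold_in /= scale1r. Qed.

Lemma kernel_eigenN1 (F : fieldType) (V : lmodType F) (phi : {linear V -> V}) :
  (kernel ((\- phi) \- idfun) : submodClosed V) =i eigen phi (-1).
Proof.
move=> v; rewrite !unfold_in /= scaleN1r opprK -oppr_eq0.
by rewrite opprB opprK addrC.
Qed.

Theorem theorem1 (F : closedFieldType) (charF : 2%N \notin [pchar F])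
    (V : lmodType F) (dimV : ~ finite_dim V)
    (f : V -> F) (quadf : quadratic_form f) (ndf : quad_nondegenerate f)
    (phi : {linear V -> V}) (orthphi : orthogonal_map f phi) :
  inner (bogolyubov orthphi) <->
  ((finitary phi /\
    ((forall v, phi v = v) \/ lin_det (quot_eigen phi 1) = 1)) \/
   (finitary (\- phi) /\
    ~ (forall v, phi v = - v) /\
    exists k : nat,
      [/\ has_dim (quot_space (eigen phi (-1))) k,
          (1 <= k)%N &
          (-1) ^+ k * lin_det (quot_eigen phi (-1)) = -1])).
Proof.
have N1 : (-1) ^+ 2 = 1 :> F by rewrite sqrrN expr1n.
have N11 : -1 <> 1 :> F.
  by move/eqP; rewrite eq_sym -addr_eq0 -mulr2n; apply/negP/two_neq0.
split=> [/(inner_reflections charF quadf ndf dimV)[us fus]|].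
(* The parity of the number of reflections selects the case: odd gives the eigenvalue -1, even gives
   1. *)
- rewrite -signr_odd; case oddus: (odd _) => /= phiE; [right | left].
    have [k [kP kdet]] := quot_eigen_dim_det charF quadf ndf N1 fus phiE.
    move: kdet; rewrite -signr_odd oddus expr1 => kdet.
    have k0 : (0 < k)%N.
      (* On a zero quotient the determinant is 1, which would give -1 = 1. *)
      rewrite lt0n; apply/eqP => k0; subst k; apply: N11.
      by rewrite -kdet mul1r lin_det0.
    split; first by exists k; apply: has_dim_quot_eq kP => v; rewrite kernel_eigenN1.
    split; last by exists k.
    (* For [phi] equal to minus the identity the quotient is zero, against [0 < k]. *)
    move=> phiN; suff kP0 : has_dim (quot_space (eigen phi (-1))) 0.
      by move: k0; rewrite (has_dim_unique kP kP0).
    exists (fun=> 0); split=> [c _ []//|]; elim/quot_ind => v; exists (fun=> 0).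
    rewrite big_ord0 -(linear0 (quot_proj (eigen phi (-1)))).
    by apply/quot_projP/eigenP; rewrite subr0 phiN scaleN1r.
  have [k [kP]] := quot_eigen_dim_det charF quadf ndf (expr1n _ 2) fus phiE.
  rewrite expr1n mul1r -signr_odd oddus => kdet; split; last by right.
  by exists k; apply: has_dim_quot_eq kP => v; rewrite kernel_eigen1.
have dim_eigen (W : submodClosed V) a : W =i eigen phi a ->
    finite_dim (quot_space W) -> finite_dim (quot_space (eigen phi a)).
  by move=> Wa [k kP]; exists k; apply: has_dim_quot_eq kP.
case=> [[/(dim_eigen _ _ (kernel_eigen1 phi)) fin phi1] |
        [/(dim_eigen _ _ (kernel_eigenN1 phi)) fin [_ [k [kP _ kdet]]]]].
- case: phi1 => [phi1|det1].
    (* The identity is the empty product of reflections. *)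
    apply: (@reflections_inner _ _ _ quadf phi orthphi [::]) => // v.
    by rewrite scale1r phi1.
  have [us fus phiE] := eigen_reflections charF quadf ndf orthphi (expr1n _ 2) fin.
  have [k kP] := fin.
  (* The determinant condition forces the number of reflections to be even. *)
  have := det_quot_eigen charF quadf ndf (expr1n _ 2) fus phiE kP.
  rewrite det1 expr1n mul1r => sgn.
  by apply: (reflections_inner quadf orthphi fus) => v; rewrite -sgn.
have [us fus phiE] := eigen_reflections charF quadf ndf orthphi N1 fin.
have := det_quot_eigen charF quadf ndf N1 fus phiE kP; rewrite kdet => sgn.
by apply: (reflections_inner quadf orthphi fus) => v; rewrite -sgn.
Qed.
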